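(* For $1<\alpha<2$, $$\|\mathcal{H}\|_{\mathcal{B}^\alpha\rightarrow\mathcal{B}^\alpha}\geq\int_{0}^{1}\frac{(1-t^2)^{1-\alpha}}{2(\alpha-1)}\,dt-\frac{1}{2(\alpha-1)}+\frac{\pi}{\sin\pi(\alpha-1)}.$$ Moreover, $\mathcal{H}$ is not bounded on $\mathcal{B}^\alpha$ when $0<\alpha\leq1$ or $\alpha\geq2$.
   Context: $\mathbb{D}$ is the open unit disk in $\mathbb{C}$ and $H(\mathbb{D})$ is the set of analytic functions on $\mathbb{D}$. For $0<\alpha<\infty$, the $\alpha$-Bloch space $\mathcal{B}^\alpha$ consists of those $f\in H(\mathbb{D})$ with $$\|f\|_{\mathcal{B}^\alpha}=|f(0)|+\sup_{z\in\mathbb{D}}(1-|z|^2)^{\alpha}|f'(z)|<\infty.$$ The Hilbert matrix operator $\mathcal{H}$ acts on $f(z)=\sum_{k\ge 0}a_kz^k\in H(\mathbb{D})$ by $$\mathcal{H}f(z)=\sum_{n=0}^\infty\left(\sum_{k=0}^\infty\frac{a_k}{n+k+1}\right)z^n,$$ whenever the right-hand side makes sense and defines an analytic function in $\mathbb{D}$. For normed spaces $X,Y$ of analytic functions, $\|\mathcal{H}\|_{X\to Y}=\sup\{\|\mathcal{H}f\|_Y:\ f\in X,\ \|f\|_X\le 1\}$. ''$\mathcal{H}$ is bounded on $X$'' means that $\mathcal{H}f$ is defined and belongs to $X$ for every $f\in X$, and $\|\mathcal{H}\|_{X\to X}<\infty$; ''not bounded'' is the negation of this. *)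

(* Defs.v *)
From HB Require Import structures.
From mathcomp Require Import all_boot all_order all_algebra.
From mathcomp Require Import all_classical all_reals all_analysis.
From mathcomp Require Import complex.
Set Implicit Arguments.
Unset Strict Implicit.
Unset Printing Implicit Defensive.
Import Order.TTheory GRing.Theory Num.Theory.
Import numFieldNormedType.Exports.
Local Open Scope classical_set_scope.
Local Open Scope complex_scope.
Local Open Scope ring_scope.

(* [R[i]^o] carries the topology induced by the modulus and is a normed module
   over the field [R[i]], so [derivable] and [f^`()%classic] below are the complex
   notions. *)
Notation cplx R := (R[i]^o).

(* The modulus with values in [R]; the library's [`|z|] is [(modc z)%:C]. *)
Notation modc := Normc.normc.

Section HilbertBloch.
Variable R : realType.
Implicit Types (f g : cplx R -> cplx R) (a : nat -> cplx R) (alpha : R).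

Definition disk : set (cplx R) := [set z | modc z < 1].

Definition analytic f := forall z, disk z -> derivable f z 1.

Definition has_taylor f a := forall z, disk z ->
  series (fun k => a k * z ^+ k) @ \oo --> f z.

(* Functions on the disk are represented by total functions whose values
   outside the disk are irrelevant; hence the Hilbert operator is a relation:
   [hilbert f g] says that H f makes sense, is analytic and equals [g] on the
   disk. *)
Definition hilbert f g := exists a b : nat -> cplx R,
  [/\ has_taylor f a,
      forall n, series (fun k => a k / (n + k + 1)%N%:R) @ \oo --> b n,
      has_taylor g b
    & analytic g].

Definition bloch_norm alpha f : \bar R :=
  ((modc (f 0))%:E + ereal_sup
    [set ((1 - modc z ^+ 2) `^ alpha * modc (f^`()%classic z))%:E | z in disk])%E.

Definition bloch alpha : set (cplx R -> cplx R) :=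
  [set f | analytic f /\ (bloch_norm alpha f < +oo)%E].

(* Supremum over those [f] for which H f is defined; [NY] is the norm of the
   target space, with value [+oo] outside of it. *)
Definition hilbert_opnorm (X : set (cplx R -> cplx R))
    (NX NY : (cplx R -> cplx R) -> \bar R) : \bar R :=
  ereal_sup [set y | exists f g,
    [/\ X f, (NX f <= 1)%E, hilbert f g & y = NY g]].

Definition hilbert_bloch_opnorm alpha : \bar R :=
  hilbert_opnorm (bloch alpha) (bloch_norm alpha) (bloch_norm alpha).

Definition hilbert_bounded_on_bloch alpha :=
  (forall f, bloch alpha f -> exists2 g, hilbert f g & bloch alpha g) /\
  (hilbert_bloch_opnorm alpha < +oo)%E.

End HilbertBloch.

(* Main.v *)
Require Import Defs.
From HB Require Import structures.
From mathcomp Require Import all_boot all_order all_algebra.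
From mathcomp Require Import all_classical all_reals all_analysis.
From mathcomp Require Import measurable_realfun complex zify ring lra.
Import Order.TTheory GRing.Theory Num.Theory.
Import numFieldNormedType.Exports.
Local Open Scope classical_set_scope.
Local Open Scope ring_scope.

(** For f with Taylor coefficients A_k >= 0, both norms reduce to real series:
    |f'(z)| <= f'(|z|), and (H f)' at r in [0, 1) is the sum of n b_n r^(n-1)
    with b_n the sum over k of A_k / (n+k+1).
    For 1 < alpha < 2 put a = alpha - 1 and test with
    f(z) = ((1 - z^2)^(-a) - 1) / (2 a), so f'(z) = z (1 - z^2)^(-alpha) and
    the norm of f is at most 1. Then (H f)(0) is the integral minus 1 / (2 a),
    while (1 - r^2)^alpha (H f)'(r) has lower limit at least pi / sin (pi a) as
    r -> 1: telescoping sums the series of b_n (a Beta integral), and n b_n is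
    then, up to the factor 1/a and bounded errors, at least the m-th coefficient
    (m = n/2) of (1 - x)^(-alpha) times the m-th partial product of Euler's
    product for pi a / sin (pi a). The product is bounded below by a Wallis-type
    recursion for antiderivatives of cos^(2n)(t) cos(2 a t).
    Unboundedness: test with 1 for alpha < 1, with partial sums of
    log (1 / (1 - z)) for alpha = 1 and of 1 / (1 - z) for alpha >= 2. *)

(** * Complex power series on the disk *)

Section ComplexSeries.
Context {R : realType}.
Local Notation "x %:C" := (real_complex R x).
Local Notation Re := (@complex.Re R).
Local Notation Im := (@complex.Im R).

Lemma normE_modc (z : cplx R) : `|z| = (modc z)%:C.
Proof. by []. Qed.

Lemma modc_real (x : R) : modc (x%:C) = `|x|.
Proof. by rewrite /= expr0n /= addr0 sqrtr_sqr. Qed.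

Lemma modc_ge0 (z : cplx R) : 0 <= modc z.
Proof. by case: z => x y /=; exact: sqrtr_ge0. Qed.

Lemma modcX (z : cplx R) n : modc (z ^+ n) = modc z ^+ n.
Proof.
by elim: n => [|n IHn]; rewrite ?expr0 ?Normc.normc1// !exprS Normc.normcM IHn.
Qed.

Lemma Re_le_modc (z : cplx R) : `|Re z| <= modc z.
Proof. by rewrite -lecR; exact: normc_ge_Re. Qed.

Lemma Im_le_modc (z : cplx R) : `|Im z| <= modc z.
Proof.
case: z => x y /=; rewrite -sqrtr_sqr ler_sqrt ?addr_ge0 ?sqr_ge0//.
by rewrite lerDr sqr_ge0.
Qed.

Lemma modc_le_ReIm (z : cplx R) : modc z <= `|Re z| + `|Im z|.
Proof.
case: z => x y /=.
rewrite -[leRHS]ger0_norm ?addr_ge0// -sqrtr_sqr; apply: ler_wsqrtr.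
rewrite -(real_normK (num_real x)) -(real_normK (num_real y)).
have := normr_ge0 x; have := normr_ge0 y; nra.
Qed.

(** A positive element of [R[i]] has zero imaginary part, so real tolerances suffice. *)
Lemma cvg_modc {T : Type} (F : set_system T) {FF : Filter F} (u : T -> cplx R) l :
  (forall e, 0 < e -> \forall n \near F, modc (l - u n) < e) -> u @ F --> l.
Proof.
move=> H; apply/cvgrPdist_lt => e; rewrite ltcE => /andP[/eqP /= e2 e0].
have {e2}-> : e = (Re e)%:C by move: e2; case: (e) => a b /= ->.
by near do rewrite normE_modc ltcR; apply: H.
Unshelve. all: end_near. Qed.

(** Real and imaginary parts converge absolutely by comparison with [v], and the two real limits are
    reassembled. *)
Lemma dominated_series (u : nat -> cplx R) (v : R^nat) :
  (forall k, modc (u k) <= v k) -> cvgn (series v) ->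
  exists2 l : cplx R, series u @ \oo --> l & modc l <= limn (series v).
Proof.
move=> uv cv.
have v0 k : 0 <= v k by exact: le_trans (modc_ge0 _) (uv k).
have cR (p : cplx R -> R) : (forall z, `|p z| <= modc z) ->
    cvgn (series (fun k => p (u k))).
  move=> pm; apply: normed_cvg; apply: (series_le_cvg _ v0 _ cv) => k //=.
  exact: le_trans (pm _) (uv k).
have [/= /cvg_ex[/= x cx] /cvg_ex[/= y cy]] :=
  (cR Re Re_le_modc, cR Im Im_le_modc).
have sReIm n : series u n = Complex (series (fun k => Re (u k)) n)
    (series (fun k => Im (u k)) n).
  elim: n => [|n IHn]; first by rewrite /series /= !big_geq.
  by rewrite !seriesSr IHn; case: (u n).
have cu : forall e, 0 < e ->
    \forall n \near \oo, modc ((Complex x y : cplx R) - series u n) < e.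
  move=> e e0; have e20 : 0 < e / 2 by rewrite divr_gt0.
  near=> n; rewrite (le_lt_trans (modc_le_ReIm _))// sReIm /=.
  rewrite (splitr e) ltrD//.
    by near: n; move/cvgrPdist_lt : cx; apply.
  by near: n; move/cvgrPdist_lt : cy; apply.
exists (Complex x y); first exact: cvg_modc.
apply/ler_addgt0Pr => e e0.
have [N _ /(_ N (leqnn N)) /= /ltW lN] := cu e e0.
set s := series u N in lN.
have := le_normcD ((Complex x y : cplx R) - s) s.
rewrite subrK => /le_trans; apply; rewrite addrC lerD//.
apply: (@le_trans _ _ (series v N)).
  rewrite /s /series /=; elim/big_ind2 : _ => //.
    by rewrite Normc.normc0.
  by move=> ? ? ? ? h1 h2; rewrite (le_trans (le_normcD _ _))// lerD.
apply: nondecreasing_cvgn_le => //.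
by apply: nondecreasing_series => n _ _.
Unshelve. all: end_near. Qed.

Lemma modc_natr n : modc (n%:R : cplx R) = n%:R.
Proof. by rewrite -(rmorph_nat (real_complex R)) modc_real ger0_norm. Qed.

(** The factor [k%:R] absorbs the truncated predecessor [0.-1 = 0]. *)
Lemma mulrn_exp_pred (K : comPzRingType) (x : K) k :
  k%:R * x ^+ k.-1 * x = k%:R * x ^+ k.
Proof. by case: k => [|k]; rewrite ?mul0r// -mulrA -exprSr. Qed.

(** One term of the binomial expansion of (r + d)^k. It lets a slightly larger radius absorb the
    factor [k] created by differentiation. *)
Lemma exprD_ge_linear (r d : R) k : 0 <= r -> 0 <= d ->
  k%:R * r ^+ k.-1 * d <= (r + d) ^+ k.
Proof.
move=> r0 d0; elim: k => [|k IHk]; first by rewrite !mul0r expr0.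
rewrite exprSr mulrDr succnK -natr1 (mulrDl _ 1) mul1r mulrDl lerD//.
  by rewrite -mulrn_exp_pred mulrAC ler_wpM2r.
by rewrite ler_wpM2r// lerXn2r ?nnegrE ?addr_ge0// lerDl.
Qed.

(* The remainder [e k] satisfies [e k.+1 = w * e k + (w - z)^2 * (k z^(k-1))]. *)
Lemma modc_expr_remainder (z w : cplx R) (r d : R) k :
  modc z <= r -> modc w <= r -> 0 < d ->
  modc (w ^+ k - z ^+ k - (w - z) * (k%:R * z ^+ k.-1)) <=
  (modc (w - z) / d) ^+ 2 * (r + d) ^+ k.
Proof.
move=> zr wr d0; have r0 : 0 <= r := le_trans (modc_ge0 z) zr.
elim: k => [|k IHk].
  rewrite mul0r mulr0 subr0 !expr0 subrr Normc.normc0 mulr1.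
  by rewrite sqr_ge0.
have -> : w ^+ k.+1 - z ^+ k.+1 - (w - z) * (k.+1%:R * z ^+ k) =
  w * (w ^+ k - z ^+ k - (w - z) * (k%:R * z ^+ k.-1)) +
  (w - z) ^+ 2 * (k%:R * z ^+ k.-1).
  rewrite -natr1 (mulrDl _ 1) mul1r -mulrn_exp_pred !exprS.
  by move: (k%:R * _) => t; ring.
rewrite (le_trans (le_normcD _ _))// Normc.normcM (Normc.normcM (_ ^+ 2)) modcX.
rewrite [(r + d) ^+ k.+1]exprSr [leRHS]mulrA [leRHS]mulrDr lerD//.
  by rewrite mulrC ler_pM ?modc_ge0.
rewrite exprMn -(mulrA (_ ^+ 2)) -(mulrA (_ ^+ 2)) (ler_wpM2l (sqr_ge0 _))//.
rewrite Normc.normcM modc_natr.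
rewrite modcX [leRHS](_ : _ = (r + d) ^+ k / d); last by field; rewrite gt_eqF.
rewrite ler_pdivlMr//.
apply: le_trans _ (exprD_ge_linear _ _ k r0 (ltW d0)).
by rewrite ler_wpM2r ?(ltW d0)// ler_wpM2l// lerXn2r ?nnegrE ?modc_ge0.
Qed.

(** * Termwise differentiation of power series *)

Definition psum (a : nat -> cplx R) (z : cplx R) : cplx R :=
  limn (series (fun k => a k * z ^+ k)).

Definition disk_summable (a : nat -> cplx R) := forall r : R, 0 <= r < 1 ->
  cvgn (series (fun k => modc (a k) * r ^+ k)).

Section PowerSeries.
Context {a : nat -> cplx R}.
Hypothesis sa : disk_summable a.

Lemma psum_has_taylor : has_taylor (psum a) a.
Proof.
move=> z z1; have z01 : 0 <= modc z < 1 by rewrite modc_ge0.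
have [k|l al _] := @dominated_series (fun k => a k * z ^+ k) _ _ (sa _ z01).
  by rewrite Normc.normcM modcX.
by rewrite /psum; have /cvg_lim -> := al.
Qed.

Lemma psum0 : psum a 0 = a 0%N.
Proof.
apply: cvg_lim => //; apply: cvg_near_cst; near=> n.
have n0 : (0 < n)%N by near: n; exact: nbhs_infty_gt.
rewrite -(prednK n0) /series /= big_nat_recl// expr0 mulr1 big1 ?addr0//.
by move=> i _; rewrite expr0n mulr0.
Unshelve. all: end_near. Qed.

(** Summing [modc_expr_remainder] against the coefficients bounds psum(z + h) - psum(z) - h b by
    (|h| / d)^2 S, with S the sum of |a_k| (r + 2 d)^k; this is o(h). *)
Lemma psum_is_derive (z : cplx R) : disk z ->
  exists2 d : cplx R, series (fun k => a k * (k%:R * z ^+ k.-1)) @ \oo --> d &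
    is_derive z (1 : cplx R) (psum a) d.
Proof.
move=> z1; pose r := modc z; have r0 : 0 <= r := modc_ge0 z.
(* A third of the gap to the unit circle: one [d] is room for the increment [h], one pays for the
   remainder estimate, and r + 2 d stays below 1. *)
pose d := (1 - r) / 3.
have d0 : 0 < d by rewrite divr_gt0// subr_gt0.
have rd1 : 0 <= r + d + d < 1.
  by move: (z1); rewrite /disk /= -/r /d => ?; apply/andP; split; lra.
have sS := sa _ rd1; set S := limn _ in sS *.
have S0 : 0 <= S.
  by apply: limr_ge => //; near=> n; rewrite /series /= sumr_ge0// => i _;
    rewrite mulr_ge0 ?modc_ge0 ?exprn_ge0//; case/andP : rd1.
have [k|b sb _] := @dominated_series (fun k => a k * (k%:R * z ^+ k.-1))
    (fun k => d^-1 *: (modc (a k) * (r + d + d) ^+ k)) _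
    (is_cvg_seriesZ (k := d^-1) sS).
  rewrite -[leRHS]/(_ * (_ * _)) Normc.normcM [leRHS]mulrCA ler_wpM2l ?modc_ge0//.
  rewrite Normc.normcM modcX modc_natr ler_pdivlMl// mulrC.
  apply: le_trans (exprD_ge_linear _ _ k r0 (ltW d0)) _.
  by rewrite lerXn2r ?nnegrE ?addr_ge0 ?(ltW d0)// lerDl ltW.
exists b; first exact: sb.
have rem (h : cplx R) : modc h <= d ->
    modc (psum a (z + h) - psum a z - h * b) <= (modc h / d) ^+ 2 * S.
  move=> hd.
  have [k|e se] := @dominated_series
      (fun k => a k * ((z + h) ^+ k - z ^+ k - h * (k%:R * z ^+ k.-1)))
      (fun k => (modc h / d) ^+ 2 *: (modc (a k) * (r + d + d) ^+ k)) _
      (is_cvg_seriesZ (k := (modc h / d) ^+ 2) sS).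
    have zr : modc z <= r + d by rewrite lerDl ltW.
    have wr : modc (z + h) <= r + d by rewrite (le_trans (le_normcD _ _))// lerD2l.
    rewrite -[leRHS]/(_ * (_ * _)) Normc.normcM [leRHS]mulrCA ler_wpM2l ?modc_ge0//.
    have := modc_expr_remainder z (z + h) _ _ k zr wr d0.
    by rewrite [z + h - z]addrAC subrr add0r.
  rewrite lim_seriesZ// -/S => /(le_trans _); apply.
  suff -> : psum a (z + h) - psum a z - h * b = e by [].
  have zh1 : disk (z + h).
    rewrite /disk /=; apply: le_lt_trans (le_normcD _ _) _.
    have := lerD (lexx r) hd; rewrite -/r.
    case/andP: rd1 => _; lra.
  have hb : (fun n => h * series (fun k => a k * (k%:R * z ^+ k.-1)) n) @ \oo
      --> h * b by exact: (@cvgMl_tmp _ _ _ _ _ h b sb).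
  have cd : series (fun k =>
      a k * ((z + h) ^+ k - z ^+ k - h * (k%:R * z ^+ k.-1))) @ \oo -->
      psum a (z + h) - psum a z - h * b.
    have cd := cvgB (cvgB (psum_has_taylor _ zh1) (psum_has_taylor _ z1)) hb.
    apply: cvg_trans (cd _ _); apply: near_eq_cvg; near=> n.
    rewrite /= /series /= !fctE mulr_sumr -!sumrB; apply: eq_bigr => i _.
    by rewrite -!mulrBr mulrCA -mulrBr.
  exact: (cvg_unique (@norm_hausdorff _ (cplx R)) cd se).
have : (fun h : cplx R => h^-1 *: (psum a (h *: 1 + z) - psum a z)) @ 0^' --> b.
  have mhlt (x : R) : 0 < x -> \forall h \near (0 : cplx R)^', modc h < x.
    move=> x0; have xC0 : 0 < x%:C by rewrite ltcR.
    have := @dnbhs0_lt _ (cplx R) _ xC0.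
    by apply: filterS => h; rewrite normE_modc ltcR.
  apply: cvg_modc => e e0.
  (* This bound on |h| gives |h| S / d^2 < e; [S + 1] avoids a division by 0. *)
  have ed0 : 0 < e * d ^+ 2 / (S + 1).
    by apply: divr_gt0; [apply: mulr_gt0 => //; exact: exprn_gt0|exact: ltr_wpDl].
  near=> h.
  have h0 : h != 0 by near: h; exact: nbhs_dnbhs_neq.
  have mh0 : 0 < modc h.
    by rewrite lt_neqAle modc_ge0 andbT eq_sym; apply: contra h0 => /eqP/Normc.eq0_normc ->.
  have hd : modc h < d by near: h; exact: mhlt.
  have he : modc h < e * d ^+ 2 / (S + 1).
    by near: h; exact: mhlt.
  have -> : b - h^-1 *: (psum a (h *: 1 + z) - psum a z) =
      - h^-1 * (psum a (z + h) - psum a z - h * b).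
    rewrite (_ : h *: 1 = h); last exact: mulr1.
    rewrite -[_ *: _]/(_ * _) (addrC z) [RHS]mulrBr !mulNr opprK.
    by rewrite mulrA (mulVf h0) mul1r [LHS]addrC.
  rewrite Normc.normcM normcN Normc.normcV mulrC ltr_pdivrMr//.
  apply: le_lt_trans (rem _ (ltW hd)) _.
  move: he; rewrite ltr_pdivlMr ?ltr_wpDl// => he.
  have he' : modc h * S < e * d ^+ 2.
    by apply: le_lt_trans he; rewrite ler_pM2l// lerDl.
  rewrite expr_div_n mulrAC ltr_pdivrMr ?exprn_gt0//.
  by rewrite expr2 -!mulrA [e * _]mulrCA ltr_pM2l.
move=> H; apply: DeriveDef; first exact: (cvgP _ H).
exact: (cvg_lim (@norm_hausdorff _ (cplx R)) H).
Unshelve. all: end_near. Qed.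

End PowerSeries.

Lemma cvg_modc_near {T : Type} (F : set_system T) {FF : Filter F}
    (u : T -> cplx R) (l : cplx R) (e : R) :
  u @ F --> l -> 0 < e -> \forall n \near F, modc (l - u n) < e.
Proof.
move=> /cvgrPdist_lt ul e0.
have eC0 : 0 < e%:C by rewrite ltcR.
by have := ul _ eC0; apply: filterS => n; rewrite normE_modc ltcR.
Qed.

Lemma cvg_real_complex (u : R^nat) (l : R) :
  u @ \oo --> l -> (fun n => (u n)%:C : cplx R) @ \oo --> (l%:C : cplx R).
Proof.
move=> /cvgrPdist_lt ul; apply: cvg_modc => e e0.
by have := ul _ e0; apply: filterS => n; rewrite -rmorphB modc_real.
Qed.

Lemma series_real_complex (u : R^nat) n :
  series (fun k => (u k)%:C : cplx R) n = (series u n)%:C.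
Proof. by rewrite /series /= rmorph_sum. Qed.

(** Partial sums increase, so each is at most a later one lying within [e] of [l], whose size is at
    most modc l + e. *)
Lemma nonneg_series_le_modc (u : R^nat) (l : cplx R) n : (forall k, 0 <= u k) ->
  series (fun k => (u k)%:C : cplx R) @ \oo --> l -> series u n <= modc l.
Proof.
move=> u0 ul; apply/ler_addgt0Pr => e e0.
have := cvg_modc_near _ _ _ _ ul e0; case=> m _ mP.
have := mP (maxn m n) (leq_maxl _ _); rewrite /= series_real_complex.
set s := series u (maxn m n) => ls.
have ns : series u n <= s.
  by apply: nondecreasing_series (leq_maxr _ _) => k _ _.
have s0 : 0 <= s by rewrite /s /series /= sumr_ge0.
apply: (le_trans ns).
have -> : s = modc (s%:C) by rewrite modc_real ger0_norm.
have := le_normcD l (- (l - s%:C)).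
rewrite subKr normcN => /le_trans; apply.
by rewrite lerD2l ltW.
Qed.

Lemma bounded_nonneg_series_cvg (u : R^nat) (M : R) : (forall k, 0 <= u k) ->
  (forall n, series u n <= M) -> cvgn (series u).
Proof.
move=> u0 uM; apply: nondecreasing_is_cvgn.
  by apply: nondecreasing_series => n _ _.
by exists M => _ [n _ <-].
Qed.

Lemma series_le_lim (u : R^nat) n : (forall k, 0 <= u k) -> cvgn (series u) ->
  series u n <= limn (series u).
Proof.
move=> u0 cu; apply: nondecreasing_cvgn_le => //.
by apply: nondecreasing_series => k _ _.
Qed.

Lemma limn_le (u : R^nat) (M : R) : cvgn u -> (forall n, u n <= M) -> limn u <= M.
Proof. by move=> cu uM; apply: limr_le => //; near=> n; exact: uM.
Unshelve. all: end_near. Qed.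

Lemma disk_real (r : R) : 0 <= r < 1 -> disk (r%:C : cplx R).
Proof. by case/andP=> r0 r1; rewrite /disk /mkset modc_real ger0_norm. Qed.

(** * Operator norm bounds from nonnegative coefficients *)

Definition hilbert_coef (A : R^nat) n := limn (series (fun k => A k / (n + k + 1)%:R)).

(** This reduces the complex problem to real series. The last hypothesis on [A] makes the norm of f
    at most 1, because |f'(z)| <= f'(|z|); the conclusion tests the norm of H f at 0 and at the real
    point [r], with a partial sum of the derivative. *)
Lemma hilbert_opnorm_ge (alpha : R) (A : R^nat) : (forall k, 0 <= A k) ->
  cvgn (series (fun k => A k / (0 + k + 1)%:R)) ->
  (forall r n, 0 <= r < 1 -> A 0%N + (1 - r ^+ 2) `^ alpha *
     series (fun k => A k * (k%:R * r ^+ k.-1)) n <= 1) ->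
  forall r n, 0 <= r < 1 ->
  ((hilbert_coef A 0%N + (1 - r ^+ 2) `^ alpha *
     series (fun k => hilbert_coef A k * (k%:R * r ^+ k.-1)) n)%:E
  <= hilbert_bloch_opnorm alpha)%E.
Proof.
move=> A0 cA nA.
have w_gt0 (r : R) : 0 <= r < 1 -> 0 < (1 - r ^+ 2) `^ alpha.
  by case/andP=> r0 r1; rewrite powR_gt0// subr_gt0 expr_lt1.
have dA0 (r : R) k : 0 <= r -> 0 <= A k * (k%:R * r ^+ k.-1).
  by move=> r0; rewrite !mulr_ge0 ?exprn_ge0.
have dAle (r : R) n : 0 <= r < 1 ->
    series (fun k => A k * (k%:R * r ^+ k.-1)) n <=
    (1 - A 0%N) / (1 - r ^+ 2) `^ alpha.
  by move=> r01; rewrite ler_pdivlMr ?w_gt0// mulrC lerBrDl nA.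
have cdA (r : R) : 0 <= r < 1 ->
    cvgn (series (fun k => A k * (k%:R * r ^+ k.-1))).
  move=> r01; apply: bounded_nonneg_series_cvg (fun n => dAle r n r01) => k.
  by apply: dA0; case/andP: r01.
have sA : disk_summable (fun k => (A k)%:C : cplx R).
  move=> r r01; have /andP[r0 r1] := r01.
  apply: (bounded_nonneg_series_cvg _ (A 0%N + (1 - A 0%N) / (1 - r ^+ 2) `^ alpha)).
    by move=> k; rewrite mulr_ge0 ?modc_ge0 ?exprn_ge0.
  (* Beyond the constant term A_k r^k <= A_k k r^(k-1), so the derivative series controls the series
     itself. *)
  move=> n; apply: (@le_trans _ _
    (A 0%N + series (fun k => A k * (k%:R * r ^+ k.-1)) n)); last first.
    by rewrite lerD2l dAle.
  have s0 (u : R^nat) : series u 0 = 0 by rewrite /series /= big_geq.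
  elim: n => [|[|n] IHn]; first by rewrite !s0 addr0.
    by rewrite !(seriesSr _ 0) !s0 !add0r modc_real ger0_norm// expr0 !mulr1 mulr0 addr0.
  rewrite !(seriesSr _ n.+1) addrA lerD// modc_real ger0_norm// ler_wpM2l//.
  rewrite exprSr mulrC ler_wpM2r ?exprn_ge0//.
  by rewrite (le_trans (ltW r1))// ler1n.
have cAn n : cvgn (series (fun k => A k / (n + k + 1)%:R)).
  apply: series_le_cvg cA => k //; rewrite ?divr_ge0//.
  rewrite ler_wpM2l// lef_pV2 ?posrE ?ltr0n ?addn1// ler_nat.
  by rewrite ltnS leq_add2r.
pose b := hilbert_coef A.
have b0 n : 0 <= b n.
  apply: limr_ge => //; near=> m.
  by rewrite /series /= sumr_ge0// => i _; rewrite divr_ge0.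
(* Bounded coefficients: a geometric series then dominates H f. *)
have bb n : b n <= b 0%N.
  apply: lim_series_le => // k.
  rewrite ler_wpM2l// lef_pV2 ?posrE ?ltr0n ?addn1// ler_nat.
  by rewrite ltnS leq_add2r.
have sb : disk_summable (fun k => (b k)%:C : cplx R).
  move=> r /andP[r0 r1].
  have /is_cvg_geometric_series : `|r| < 1 by rewrite ger0_norm.
  move=> /(_ (b 0%N)); apply: series_le_cvg => k.
  - by rewrite mulr_ge0 ?modc_ge0 ?exprn_ge0.
  - by rewrite /geometric /= mulr_ge0 ?exprn_ge0.
  - by rewrite modc_real ger0_norm//= ler_wpM2r ?exprn_ge0.
set f := psum (fun k => (A k)%:C); set g := psum (fun k => (b k)%:C).
have an c : disk_summable c -> analytic (psum c).
  by move=> sc z /(psum_is_derive sc)[d _ []].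
have fg : hilbert f g.
  exists (fun k => (A k)%:C), (fun k => (b k)%:C); split.
  - exact: psum_has_taylor.
  - move=> n; have := cvg_real_complex _ _ (cAn n).
    apply: cvg_trans; apply: near_eq_cvg; near=> m.
    rewrite -series_real_complex; congr (series _ m); apply/funext => k.
    by rewrite fmorph_div rmorph_nat.
  - exact: psum_has_taylor.
  - exact: an.
have nf : (bloch_norm alpha f <= 1)%E.
  rewrite /bloch_norm /f psum0 modc_real ger0_norm//.
  have -> : 1%E = ((A 0%N)%:E + (1 - A 0%N)%:E)%E :> \bar R.
    by rewrite -EFinD addrC subrK.
  apply: leeD2l; apply: ge_ereal_sup => _ [z z1 <-].
  have z01 : 0 <= modc z < 1 by rewrite modc_ge0.
  have [d sd dd] := psum_is_derive sA z z1.
  rewrite lee_fin derive1E derive_val.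
  have [k|l sl ml] := dominated_series
      (fun k => (A k)%:C * (k%:R * z ^+ k.-1)) _ _ (cdA _ z01).
    rewrite !Normc.normcM modc_real modcX modc_natr (ger0_norm (A0 k)).
    exact: lexx.
  rewrite (cvg_unique (@norm_hausdorff _ (cplx R)) sd sl).
  rewrite mulrC -ler_pdivlMr ?w_gt0// (le_trans ml)//.
  by apply: limn_le => [|n]; [exact: cdA|exact: dAle].
move=> r n r01; have rd := disk_real _ r01.
apply: (@le_trans _ _ (bloch_norm alpha g)); last first.
  apply: ereal_sup_ubound; exists f, g; split => //; split; first exact: an.
  by rewrite (le_lt_trans nf)// ltry.
rewrite /bloch_norm EFinD /g psum0 modc_real ger0_norm//.
apply: leeD2l; apply: ereal_sup_ge; eexists; first by exists (r%:C).
rewrite lee_fin modc_real real_normK ?num_real// ler_wpM2l ?(ltW (w_gt0 _ _))//.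
have [d sd dd] := psum_is_derive sb _ rd.
rewrite derive1E derive_val; apply: nonneg_series_le_modc.
  by move=> k; rewrite !mulr_ge0 ?exprn_ge0//; case/andP : r01.
apply: cvg_trans sd; apply: near_eq_cvg; near=> m.
congr (series _ m); apply/funext => k.
by rewrite !rmorphM rmorphXn rmorph_nat.
Unshelve. all: end_near. Qed.

End ComplexSeries.

(** * The exponents where H is unbounded *)

Section Unbounded.
Context {R : realType}.

Lemma finite_series_cvg (u : R^nat) K : (forall k, (K <= k)%N -> u k = 0) ->
  cvgn (series u).
Proof.
move=> uK; apply: (cvgP (series u K)); apply: cvg_near_cst; near=> n.
have Kn : (K <= n)%N by near: n; exact: nbhs_infty_ge.
rewrite /series /= (big_cat_nat _ Kn) //= [X in _ + X]big1_seq ?addr0//.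
by move=> k; rewrite mem_index_iota => /andP[_ /andP[/uK]].
Unshelve. all: end_near. Qed.

Lemma hilbert_coef_ge (A : R^nat) n m : (forall k, 0 <= A k) ->
  cvgn (series (fun k => A k / (0 + k + 1)%:R)) ->
  series (fun k => A k / (n + k + 1)%:R) m <= hilbert_coef A n.
Proof.
move=> A0 cA; apply: series_le_lim => [k|]; first by rewrite divr_ge0.
apply: series_le_cvg cA => k //; rewrite ?divr_ge0//.
rewrite ler_wpM2l// lef_pV2 ?posrE ?ltr0n ?addn1// ler_nat.
by rewrite ltnS leq_add2r.
Qed.

Lemma harmonic_unbounded (M : R) : exists n, M < series harmonic n.
Proof.
apply: contrapT => /forallNP nM; apply: (@dvg_harmonic R).
apply: (bounded_nonneg_series_cvg _ M) => [k|n]; first exact: harmonic_ge0.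
by have /negP := nM n; rewrite -leNgt.
Qed.

Lemma arith_geom_series_le (r : R) n : 0 <= r < 1 ->
  series (fun k => k%:R * r ^+ k.-1) n * (1 - r) ^+ 2 <= 1.
Proof.
case/andP=> r0 r1.
(* Closed form of the finite sum; the two extra terms are the nonnegative truncation error. *)
suff e : series (fun k => k%:R * r ^+ k.-1) n * (1 - r) ^+ 2 +
    (n%:R * r ^+ n.-1 * (1 - r) + r ^+ n) = 1.
  by rewrite -[leRHS]e lerDl addr_ge0 ?mulr_ge0 ?exprn_ge0// subr_ge0 ltW.
elim: n => [|n IHn].
  by rewrite /series /= big_geq// !mul0r !add0r expr0.
rewrite -[RHS]IHn seriesSr /= mulrDl -addrA; congr (_ + _).
by rewrite -natr1 (mulrDl _ 1) mul1r (exprSr r n) -mulrn_exp_pred; ring.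
Qed.

Lemma bernoulli_le (x : R) n : 0 <= x <= 1 -> 1 - n%:R * x <= (1 - x) ^+ n.
Proof.
case/andP=> x0 x1; elim: n => [|n IHn]; first by rewrite mul0r subr0 expr0.
rewrite exprS; have x1' : 0 <= 1 - x by rewrite subr_ge0.
apply: le_trans (ler_wpM2l x1' IHn).
have : 0 <= n%:R * x ^+ 2 by rewrite mulr_ge0 ?sqr_ge0.
rewrite -natr1; nra.
Qed.

(* At [r = 1 - 1 / (4 K)] one has [r^n >= 1/2] for [n <= 2 K], by Bernoulli. *)
Lemma series_lower_bound (u : R^nat) (c : R) K : (0 < K)%N -> 0 <= c ->
  (forall n, 0 <= u n) -> (forall n, (K < n)%N -> c <= n%:R * u n) ->
  K%:R * c / 2 <=
  series (fun n => u n * (n%:R * (1 - (4 * K)%:R^-1) ^+ n.-1)) (K + K).+1.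
Proof.
move=> K0 c0 u0 uc; set r := 1 - _.
have K0' : 0 < K%:R :> R by rewrite ltr0n.
have x01 : 0 <= ((4 * K)%:R^-1 : R) <= 1.
  by rewrite invr_ge0 ler0n invf_le1 ?ler1n ?ltr0n muln_gt0.
have r01 : 0 <= r <= 1 by case/andP: x01 => ? ?; rewrite /r; lra.
have r0 : 0 <= r by case/andP: r01.
have rK n : (n <= K + K)%N -> 1 / 2 <= r ^+ n.
  move=> nK; apply: le_trans (bernoulli_le _ n x01).
  have : n%:R <= K%:R + K%:R :> R by rewrite -natrD ler_nat.
  have -> : n%:R * (4 * K)%:R^-1 = n%:R / K%:R / 4 :> R.
    by rewrite natrM; field; rewrite gt_eqF.
  rewrite -mulr2n -[_ *+ 2]mulr_natr mulrC -ler_pdivrMr// => ?; lra.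
(* Only the [K] indices from K + 1 to 2 K are kept; each contributes at least c / 2. *)
rewrite /series /= (big_cat_nat _ (n := K.+1))//=; last by rewrite ltnS leq_addr.
rewrite ler_wpDl ?sumr_ge0//; first by move=> i _; rewrite !mulr_ge0 ?exprn_ge0.
apply: (@le_trans _ _ (\sum_(K.+1 <= i < (K + K).+1) c / 2)).
  by rewrite sumr_const_nat subSS addnK -[(c / 2) *+ K]mulr_natl mulrA.
apply: ler_sum_nat => i /andP[Ki iK].
rewrite [leRHS]mulrA (mulrC (u i)) ler_pM// ?divr_ge0//; first exact: uc.
by rewrite -div1r rK//; case: i Ki iK => //= i _ /ltnW.
Qed.

Lemma bounded_opnorm (alpha : R) : hilbert_bounded_on_bloch alpha ->
  exists L : R, (hilbert_bloch_opnorm alpha <= L%:E)%E.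
Proof.
case=> _; case: (hilbert_bloch_opnorm alpha) => [x| |] // _.
  by exists x.
by exists 0; rewrite leNye.
Qed.

(** Since (1 - r^2)^alpha <= 4 (1 - r)^2 and the sum of k r^(k-1) is at most (1 - r)^(-2),
    coefficients 1/5 give norm at most 1/5 + 4/5. Already (H f)(0) is a fifth of a harmonic sum. *)
Lemma unbounded_ge2 (alpha : R) : 2 <= alpha -> ~ hilbert_bounded_on_bloch alpha.
Proof.
move=> a2 /bounded_opnorm[L HL].
have [K] := harmonic_unbounded (5 * L).
apply/negP; rewrite -leNgt.
pose A k : R := if (k < K)%N then 5^-1 else 0.
have A0 k : 0 <= A k by rewrite /A; case: ifP.
have cA : cvgn (series (fun k => A k / (0 + k + 1)%:R)).
  by apply: (finite_series_cvg _ K) => k Kk; rewrite /A ltnNge Kk mul0r.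
have nA (r : R) n : 0 <= r < 1 -> A 0%N + (1 - r ^+ 2) `^ alpha *
     series (fun k => A k * (k%:R * r ^+ k.-1)) n <= 1.
  move=> r01; have /andP[r0 r1] := r01.
  have r21 : 0 < 1 - r ^+ 2 <= 1.
    by rewrite subr_gt0 expr_lt1// r1 lerBlDr lerDl sqr_ge0.
  have A5 k : A k <= 5^-1 by rewrite /A; case: ifP.
  have Sle : series (fun k => A k * (k%:R * r ^+ k.-1)) n <=
      5^-1 * series (fun k => k%:R * r ^+ k.-1) n.
    rewrite /series /= mulr_sumr; apply: ler_sum => i _.
    by rewrite ler_wpM2r ?mulr_ge0 ?exprn_ge0.
  have w0 : 0 <= (1 - r ^+ 2) `^ alpha by exact: powR_ge0.
  have w2 : (1 - r ^+ 2) `^ alpha <= 4 * (1 - r) ^+ 2.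
    apply: (@le_trans _ _ ((1 - r ^+ 2) `^ 2%:R)); first exact: ger_powR.
    rewrite powR_mulrn; last by case/andP: r21 => /ltW.
    have -> : 1 - r ^+ 2 = (1 + r) * (1 - r) by ring.
    by rewrite exprMn ler_wpM2r ?sqr_ge0//; nra.
  have := arith_geom_series_le r n r01; set S := series _ _ => S1.
  have S0 : 0 <= S by rewrite /S /series /= sumr_ge0// => i _; rewrite mulr_ge0 ?exprn_ge0.
  have SA0 : 0 <= series (fun k => A k * (k%:R * r ^+ k.-1)) n.
    by rewrite /series /= sumr_ge0// => i _; rewrite !mulr_ge0 ?exprn_ge0.
  have := ler_pM w0 SA0 w2 Sle; rewrite -/S; have := A5 0%N; lra.
have r00 : 0 <= (0 : R) < 1 by rewrite lexx ltr01.
have := le_trans (hilbert_opnorm_ge _ _ A0 cA nA _ 0 r00) HL.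
rewrite lee_fin /series /= big_geq// mulr0 addr0 => bL.
have := le_trans (hilbert_coef_ge _ 0 K A0 cA) bL.
have -> : series (fun k => A k / (0 + k + 1)%:R) K = 5^-1 * series harmonic K.
  rewrite /series /= mulr_sumr; apply: eq_big_nat => k /andP[_ kK].
  by rewrite /A kK add0n addn1.
by rewrite ler_pdivrMl.
Qed.

(** Evaluation at r = 1 - x with x = 1 / (4 K): as 1 - r^2 >= x, the weight is at least (4
    K)^(-alpha), and it multiplies the K c / 2 of [series_lower_bound]. *)
Lemma hilbert_opnorm_ge_coef (alpha : R) (A : R^nat) (c : R) K :
  0 < alpha -> (forall k, 0 <= A k) ->
  cvgn (series (fun k => A k / (0 + k + 1)%:R)) ->
  (forall r n, 0 <= r < 1 -> A 0%N + (1 - r ^+ 2) `^ alpha *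
     series (fun k => A k * (k%:R * r ^+ k.-1)) n <= 1) ->
  (0 < K)%N -> 0 <= c ->
  (forall n, (K < n)%N -> c <= n%:R * hilbert_coef A n) ->
  (((4 * K)%:R `^ (1 - alpha) * c / 8)%:E <= hilbert_bloch_opnorm alpha)%E.
Proof.
move=> a0 A0 cA nA K0 c0 hc.
have b0 n : 0 <= hilbert_coef A n.
  by apply: le_trans (hilbert_coef_ge _ n 0 A0 cA); rewrite /series /= big_geq.
have K40 : 0 < (4 * K)%:R :> R by rewrite ltr0n muln_gt0.
have x01 : 0 < ((4 * K)%:R^-1 : R) < 1.
  by rewrite invr_gt0 K40 invf_lt1// ltr1n; lia.
set x := _^-1 in x01.
have r01 : 0 <= 1 - x < 1 by case/andP: x01 => ? ?; lra.
apply: le_trans (hilbert_opnorm_ge _ _ A0 cA nA _ (K + K).+1 r01).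
have := series_lower_bound _ _ _ K0 c0 b0 hc.
rewrite -/x lee_fin => SK; apply: ler_wpDl; first exact: b0.
have xa : x `^ alpha <= (1 - (1 - x) ^+ 2) `^ alpha.
  by apply: ge0_ler_powR; rewrite ?nnegrE ?(ltW a0)//; case/andP: x01 => ? ?; nra.
apply: le_trans (ler_pM _ _ xa SK); rewrite ?powR_ge0//; last first.
  by rewrite !mulr_ge0.
rewrite /x -(powR_inv1 (ltW K40)) -powRrM mulN1r.
rewrite powRD; last by rewrite (gt_eqF K40) implybT.
rewrite powRr1 ?(ltW K40)// natrM le_eqVlt; apply/orP; left; apply/eqP.
by field.
Qed.

(** H 1 has coefficients 1 / (n + 1), so c = 1/2 is admissible and the norm is at least (4 K)^(1 -
    alpha) / 16, unbounded in [K]. *)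
Lemma unbounded_lt1 (alpha : R) : 0 < alpha -> alpha < 1 ->
  ~ hilbert_bounded_on_bloch alpha.
Proof.
move=> a0 a1 /bounded_opnorm[L HL].
pose A (k : nat) : R := (k == 0)%:R.
have A0 k : 0 <= A k by rewrite ler0n.
have cA : cvgn (series (fun k => A k / (0 + k + 1)%:R)).
  by apply: (finite_series_cvg _ 1) => -[|k]// _; rewrite mul0r.
have nA (r : R) n : 0 <= r < 1 -> A 0%N + (1 - r ^+ 2) `^ alpha *
     series (fun k => A k * (k%:R * r ^+ k.-1)) n <= 1.
  move=> _; rewrite /series /= big1 ?mulr0 ?addr0// => -[|k] _.
    by rewrite !mul0r mulr0.
  by rewrite mul0r.
have bn n : n.+1%:R^-1 <= hilbert_coef A n.
  have := hilbert_coef_ge A n 1 A0 cA.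
  by rewrite /series /= big_nat1 /A mul1r addn0 addn1.
have [K [K0 LK]] : exists K, (0 < K)%N /\ `|L| * 16 + 1 < (4 * K)%:R `^ (1 - alpha).
  set M := `|L| * 16 + 1; have M0 : 0 < M by rewrite ltr_wpDl.
  exists (Num.truncn (M `^ (1 - alpha)^-1)).+1; split => //.
  have y0 : 0 < 1 - alpha by rewrite subr_gt0.
  have {1}-> : M = (M `^ (1 - alpha)^-1) `^ (1 - alpha).
    by rewrite -powRrM mulVf ?gt_eqF// powRr1// ltW.
  apply: gt0_ltr_powR => //; rewrite ?nnegrE ?powR_ge0//.
  by apply: lt_le_trans (truncnS_gt _) _; rewrite ler_nat leq_pmull.
have h0 : 0 <= 2^-1 :> R by [].
have hb n : (K < n)%N -> 2^-1 <= n%:R * hilbert_coef A n.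
  move=> Kn; apply: (@le_trans _ _ (n%:R / n.+1%:R)); last first.
    by rewrite ler_wpM2l.
  rewrite ler_pdivlMr ?ltr0n// -(natr1 n) mulrDr mulr1.
  have : 1 <= n%:R :> R by rewrite ler1n (leq_trans _ Kn).
  lra.
have := le_trans (hilbert_opnorm_ge_coef _ _ _ _ a0 A0 cA nA K0 h0 hb) HL.
rewrite lee_fin; have := ler_norm L; lra.
Qed.

(** The power of 4 K is now trivial, so growth must come from [c]: for k <= K < n the denominators n
    + k + 1 are at most 2 (n + 1), which leaves a harmonic sum as a factor. *)
Lemma unbounded_1 : ~ hilbert_bounded_on_bloch (1 : R).
Proof.
move=> /bounded_opnorm[L HL].
(* 64 = 2 * 4 * 8: the 1/2 in [A], the 1/4 in [hb] and the 1/8 of [hilbert_opnorm_ge_coef]. *)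
have [K hK] := harmonic_unbounded (64 * `|L|).
have K0 : (0 < K)%N.
  case: K hK => //; rewrite /series /= big_geq// => /lt_geF/negP; case.
  by rewrite mulr_ge0.
(* The convention [0^-1 = 0] makes the constant coefficient vanish; the 1/2 offsets 1 + r <= 2 in
   the weight. *)
pose A k : R := if (k <= K)%N then k%:R^-1 / 2 else 0.
have A0 k : 0 <= A k by rewrite /A; case: ifP.
have cA : cvgn (series (fun k => A k / (0 + k + 1)%:R)).
  by apply: (finite_series_cvg _ K.+1) => k Kk; rewrite /A leqNgt Kk mul0r.
have nA (r : R) n : 0 <= r < 1 -> A 0%N + (1 - r ^+ 2) `^ 1 *
     series (fun k => A k * (k%:R * r ^+ k.-1)) n <= 1.
  move=> /andP[r0 r1].
  have -> : A 0%N = 0 by rewrite /A leq0n invr0 mul0r.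
  rewrite powRr1; last by rewrite subr_ge0 expr_le1// ltW.
  have : series (fun k => A k * (k%:R * r ^+ k.-1)) n * (1 - r) <= 2^-1.
    case: n => [|n]; first by rewrite /series /= big_geq// mul0r.
    apply: (@le_trans _ _ (2^-1 * series (geometric 1 r) n * (1 - r))).
      rewrite ler_wpM2r ?subr_ge0 ?(ltW r1)//.
      rewrite /series /= mulr_sumr big_nat_recl// mul0r mulr0 add0r.
      apply: ler_sum => i _; rewrite /geometric /= mul1r mulrA ler_wpM2r ?exprn_ge0// /A.
      by case: ifP; rewrite ?mul0r// mulrAC mulVf ?mul1r// pnatr_eq0.
    rewrite geometric_seriesE ?lt_eqF//= mul1r -mulrA divfK ?subr_eq0 ?gt_eqF//.
    by rewrite ler_piMr// gerBl exprn_ge0.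
  set S := series _ _ => Sr; have := ler_wpM2r (_ : 0 <= 1 + r) Sr.
  rewrite addr_ge0// => /(_ isT); lra.
pose h : R := series harmonic K / 2.
have h0 : 0 <= h.
  rewrite /h divr_ge0// (le_trans _ (ltW hK))// mulr_ge0//.
have bn n : (K < n)%N -> h / (2 * n.+1%:R) <= hilbert_coef A n.
  move=> Kn; apply: le_trans (hilbert_coef_ge _ n K.+1 A0 cA).
  rewrite /h /series /= big_nat_recl// {1}/A leq0n invr0 !mul0r add0r.
  rewrite !mulr_suml; apply: ler_sum_nat => i /andP[_ iK].
  rewrite /A iK ler_wpM2l// lef_pV2 ?posrE ?mulr_gt0 ?ltr0n ?addn1//.
  by rewrite -natrM ler_nat; lia.
have hb n : (K < n)%N -> h / 4 <= n%:R * hilbert_coef A n.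
  move=> Kn; apply: (@le_trans _ _ (n%:R * (h / (2 * n.+1%:R)))); last first.
    by rewrite ler_wpM2l// bn.
  have n1 : 1 <= n%:R :> R by rewrite ler1n (leq_trans _ Kn).
  rewrite mulrA ler_pdivlMr ?mulr_gt0 ?ltr0n// -(natr1 n).
  nra.
have h40 : 0 <= h / 4 by rewrite divr_ge0.
have := le_trans (hilbert_opnorm_ge_coef _ _ _ _ ltr01 A0 cA nA K0 h40 hb) HL.
rewrite lee_fin subrr powRr0 mul1r /h; have := ler_norm L; lra.
Qed.

End Unbounded.

(** * The binomial series *)

Section BinomialSeries.
Context {R : realType}.
Implicit Types (a b x : R).

(* The coefficient of [x^k] in [(1 - x)^(-b)]. *)
Definition bincoef b k : R := \prod_(i < k) ((b + i%:R) / i.+1%:R).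

Lemma bincoef0 b : bincoef b 0 = 1.
Proof. by rewrite /bincoef big_ord0. Qed.

Lemma bincoefS b k : bincoef b k.+1 * k.+1%:R = bincoef b k * (b + k%:R).
Proof. by rewrite /bincoef big_ord_recr /= -mulrA divfK// pnatr_eq0. Qed.

Lemma bincoef_ge0 b k : 0 <= b -> 0 <= bincoef b k.
Proof. by move=> b0; apply: prodr_ge0 => i _; rewrite divr_ge0// addr_ge0. Qed.

Lemma is_derive_series_exprn (u : R^nat) n x :
  is_derive x (1 : R) (fun y => series (fun k => u k * y ^+ k) n)
    (series (fun k => u k * (k%:R * x ^+ k.-1)) n).
Proof.
elim: n => [|n IHn].
  have -> : (fun y => series (fun k => u k * y ^+ k) 0) = cst 0.
    by apply/funext => y; rewrite /series /= big_geq.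
  rewrite /series /= big_geq//; exact: is_derive_cst.
have -> : (fun y => series (fun k => u k * y ^+ k) n.+1) =
    (fun y => series (fun k => u k * y ^+ k) n) + (fun y => u n * y ^+ n).
  by apply/funext => y; rewrite seriesSr.
rewrite seriesSr; apply: is_deriveD.
have D := is_deriveZ (u n) (is_deriveX n (is_derive_id x (1 : R))).
have -> : (fun y => u n * y ^+ n) = u n \*: (id : R -> R) ^+ n.
  by apply/funext => y; rewrite /= exprfctE.
by apply: is_derive_eq D _; congr (u n * _); exact: mulr1.
Qed.

(** The differential equation (1 - x) S' = b S of (1 - x)^(-b), for partial sums; the last term is
    the truncation error. *)
Lemma bincoef_dseries b n x :
  (1 - x) * series (fun k => bincoef b k * (k%:R * x ^+ k.-1)) n =
  b * series (fun k => bincoef b k * x ^+ k) n -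
  bincoef b n * (n%:R * x ^+ n.-1).
Proof.
elim: n => [|n IHn].
  by rewrite /series /= !big_geq// mul0r !mulr0 subrr.
rewrite !seriesSr mulrDr IHn [in RHS]mulrDr [bincoef b n.+1 * _]mulrA bincoefS.
have := mulrn_exp_pred R x n; set t := _ * _ ^+ _.-1 => tx.
by rewrite -[x ^+ n.+1.-1]/(x ^+ n) [in RHS]mulrDr mulrDl -[_ * n%:R * _]mulrA -tx; ring.
Qed.

Lemma is_derive_powR_onem b x : x < 1 ->
  is_derive x (1 : R) (fun y => (1 - y) `^ b) (- (b * (1 - x) `^ (b - 1))).
Proof.
move=> x1; have x1' : 1 - x \in `]0, +oo[ by rewrite in_itv /= andbT subr_gt0.
have Dp : is_derive (1 - x) (1 : R) ((@powR R) ^~ b) (b * (1 - x) `^ (b - 1)).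
  by apply: DeriveDef; [exact: derivable_powR|rewrite -derive1E powR_derive1].
have Dx : is_derive x (1 : R) (fun y => 1 - y) (-1 : R).
  apply: is_derive_eq (is_deriveB (is_derive_cst (1 : R) x (1 : R)) (is_derive_id x (1 : R))) _.
  by rewrite sub0r.
have := @is_derive1_comp R (fun y => y `^ b) (fun y => 1 - y) x _ _ Dp Dx.
by rewrite mulrN1.
Qed.

Lemma powR_succ b x : x < 1 -> (1 - x) `^ b = (1 - x) * (1 - x) `^ (b - 1).
Proof.
move=> x1; have x1' : 0 < 1 - x by rewrite subr_gt0.
rewrite -{2}[1 - x]powRr1 ?(ltW x1')// -powRD ?(gt_eqF x1') ?implybT//.
by rewrite [1 + (b - 1)]addrC subrK.
Qed.

(* The product is 1 at [x = 0] and its derivative is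
   [- (1 - x)^(b-1) * (n+1) c_(n+1) x^n], where [c = bincoef b]. *)
Lemma bincoef_series_bounds b x n : 0 <= b -> 0 <= x < 1 ->
  1 - x / (1 - x) * (bincoef b n.+1 * (n.+1%:R * x ^+ n)) <=
  (1 - x) `^ b * series (fun k => bincoef b k * x ^+ k) n.+1 <= 1.
Proof.
move=> b0 /andP[x0 x1].
pose G (y : R) : R := (1 - y) `^ b * series (fun k => bincoef b k * y ^+ k) n.+1.
pose dG (y : R) : R := - ((1 - y) `^ (b - 1) * (bincoef b n.+1 * (n.+1%:R * y ^+ n))).
have GD (y : R) : y < 1 -> is_derive y (1 : R) G (dG y).
  move=> y1; have Dp := is_derive_powR_onem b y y1.
  have Ds := is_derive_series_exprn (bincoef b) n.+1 y.
  apply: (is_derive_eq (is_deriveM Dp Ds)); rewrite /dG (powR_succ b)//.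
  set p := _ `^ _; set D := series _ _; set S := series _ _.
  have : (1 - y) * D = b * S - bincoef b n.+1 * (n.+1%:R * y ^+ n).
    exact: bincoef_dseries.
  set T := bincoef _ _ * _ => E.
  transitivity ((1 - y) * p * D + S * - (b * p)); first by [].
  have -> : (1 - y) * p * D = p * ((1 - y) * D) by ring.
  by rewrite E; ring.
have G0 : G 0 = 1.
  rewrite /G subr0 powR1 mul1r /series /= big_nat_recl// big1 ?addr0.
    by rewrite bincoef0 mul1r expr0.
  by move=> i _; rewrite expr0n mulr0.
have [||c c0x] := @MVT_segment R G dG 0 x x0.
- by move=> y; rewrite in_itv /= => /andP[_ yx]; apply: GD; exact: lt_trans x1.
- apply: derivable_within_continuous => y; rewrite in_itv /= => /andP[_ yx].
  by have [] := GD y (le_lt_trans yx x1).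
rewrite G0 subr0 => GE.
move: c0x; rewrite in_itv /= => /andP[c0 cx].
have c1 : c < 1 by exact: le_lt_trans x1.
have -> : (1 - x) `^ b * series (fun k => bincoef b k * x ^+ k) n.+1 = 1 + dG c * x.
  by rewrite -GE [RHS]addrC subrK.
have t0 : 0 <= bincoef b n.+1 * (n.+1%:R * c ^+ n).
  by rewrite !mulr_ge0 ?bincoef_ge0 ?exprn_ge0.
apply/andP; split; last first.
  rewrite gerDl /dG mulNr oppr_le0; apply: mulr_ge0 => //.
  by apply: mulr_ge0; [exact: powR_ge0|exact: t0].
rewrite /dG mulNr.
(* Comparison with 1 / (1 - c) uses only b >= 0, whatever the sign of b - 1. *)
have wc : (1 - c) `^ (b - 1) <= (1 - x)^-1.
  apply: (@le_trans _ _ (1 - c)^-1); last first.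
    by rewrite lef_pV2 ?posrE ?subr_gt0// lerD2l lerN2.
  rewrite -[leRHS]mul1r ler_pdivlMr ?subr_gt0// mulrC -(powR_succ b)//.
  apply: (@le_trans _ _ (1 `^ b)); last by rewrite powR1.
  by apply: ge0_ler_powR; rewrite ?nnegrE ?subr_ge0 ?(ltW c1)// gerBl.
rewrite lerD2l lerN2 (mulrC x) [leRHS]mulrAC ler_wpM2r// ler_pM ?powR_ge0//.
by rewrite !ler_wpM2l ?bincoef_ge0// lerXn2r ?nnegrE.
Qed.

(** The upper bound of [bincoef_series_bounds] bounds the partial sums, hence by [bincoef_dseries]
    those of the differentiated series. The terms of the latter thus tend to 0, and the two bounds
    squeeze the product to 1. *)
Lemma bincoef_series_cvg b x : 0 <= b -> 0 <= x < 1 ->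
  series (fun k => bincoef b k * x ^+ k) @ \oo --> (1 - x) `^ (- b).
Proof.
move=> b0 x01; have /andP[x0 x1] := x01.
have w0 : 0 < (1 - x) `^ b by rewrite powR_gt0// subr_gt0.
have t0 k : 0 <= bincoef b k * (k%:R * x ^+ k.-1).
  by rewrite !mulr_ge0 ?bincoef_ge0 ?exprn_ge0.
have Sle n : series (fun k => bincoef b k * x ^+ k) n <= ((1 - x) `^ b)^-1.
  case: n => [|n]; first by rewrite /series /= big_geq// invr_ge0 ltW.
  rewrite -[leRHS]mul1r ler_pdivlMr// mulrC.
  by have /andP[_] := bincoef_series_bounds b x n b0 x01.
have cd : cvgn (series (fun k => bincoef b k * (k%:R * x ^+ k.-1))).
  apply: (bounded_nonneg_series_cvg _ (b * ((1 - x) `^ b)^-1 / (1 - x))) => // n.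
  rewrite ler_pdivlMr ?subr_gt0// mulrC bincoef_dseries.
  by rewrite (le_trans (_ : _ <= b * series (fun k => bincoef b k * x ^+ k) n)) ?gerBl// ler_wpM2l.
have e0 := cvg_series_cvg_0 cd.
have e1 : (fun n => 1 - x / (1 - x) * (bincoef b n.+1 * (n.+1%:R * x ^+ n))) @ \oo
    --> (1 : R).
  rewrite -[X in _ --> X](subr0 1) -[X in _ --> _ - X](mulr0 (x / (1 - x))).
  apply: cvgB; [exact: cvg_cst|apply: cvgMl_tmp].
  by move: e0; rewrite -cvg_shiftS.
have wS : (fun n => (1 - x) `^ b * series (fun k => bincoef b k * x ^+ k) n.+1) @ \oo
    --> (1 : R).
  apply: squeeze_cvgr e1 (cvg_cst (1 : R)).
  by near=> n; exact: bincoef_series_bounds.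
rewrite powRN -[X in _ --> X]mulr1 -cvg_shiftS.
rewrite (_ : [sequence _]_n = fun n => ((1 - x) `^ b)^-1 *
    ((1 - x) `^ b * series (fun k => bincoef b k * x ^+ k) n.+1)).
  exact: cvgMl_tmp wS.
by apply/funext => n; rewrite /= mulKf// gt_eqF.
Unshelve. all: end_near. Qed.

Lemma bincoef_series_le b x n : 0 <= b -> 0 <= x < 1 ->
  series (fun k => bincoef b k * x ^+ k) n <= (1 - x) `^ (- b).
Proof.
move=> b0 x01; have /andP[x0 _] := x01; have c := bincoef_series_cvg _ _ b0 x01.
rewrite -(cvg_lim (@norm_hausdorff _ R) c); apply: series_le_lim.
  by move=> k; rewrite mulr_ge0 ?bincoef_ge0 ?exprn_ge0.
exact: (cvgP _ c).
Qed.

End BinomialSeries.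

(** * Beta sums and their link with Euler's product *)

Section BetaSum.
Context {R : realType} {a : R}.
Hypothesis a01 : 0 < a < 1.

Let a0 : 0 < a. Proof. by case/andP: a01. Qed.
Let a1 : a < 1. Proof. by case/andP: a01. Qed.

Lemma bincoef_nonincreasing : nonincreasing_seq (bincoef a).
Proof.
apply/nonincreasing_seqP => n.
rewrite -(ler_pM2r (_ : 0 < n.+1%:R)) ?ltr0n// bincoefS.
rewrite ler_wpM2l ?bincoef_ge0 ?(ltW a0)// -natr1 addrC lerD2l.
exact: ltW.
Qed.

(** Telescoping: (1 - a) c_k / (k + 1) = c_k - c_(k+1) for c = [bincoef a]. *)
Lemma bincoef_series_harmonic n :
  (1 - a) * series (fun k => bincoef a k / k.+1%:R) n = 1 - bincoef a n.
Proof.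
elim: n => [|n IHn]; first by rewrite /series /= big_geq// mulr0 bincoef0 subrr.
rewrite seriesSr mulrDr IHn.
have n0 : n.+1%:R != 0 :> R by rewrite pnatr_eq0.
rewrite -[bincoef a n.+1](mulfK n0) bincoefS -natr1; field.
by rewrite natr1.
Qed.

(** If c_N >= e, monotonicity makes the telescoped sum at least e times a harmonic sum, while it is
    at most 1 / (1 - a). *)
Lemma bincoef_cvg0 : bincoef a @ \oo --> 0.
Proof.
have u0 k : 0 <= bincoef a k by rewrite bincoef_ge0// ltW.
apply/cvgrPdist_lt => e e0.
have [N hN] := harmonic_unbounded ((1 - a)^-1 / e).
near=> n; rewrite sub0r normrN ger0_norm//.
have Nn : (N <= n)%N by near: n; exact: nbhs_infty_ge.
apply: (le_lt_trans (bincoef_nonincreasing _ _ Nn)).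
have uN : bincoef a N * series harmonic N <= (1 - a)^-1.
  apply: (@le_trans _ _ (series (fun k => bincoef a k / k.+1%:R) N)).
    rewrite /series /= mulr_sumr; apply: ler_sum_nat => i /andP[_ iN].
    by rewrite ler_wpM2r// bincoef_nonincreasing// ltnW.
  rewrite -[leRHS]mul1r ler_pdivlMr ?subr_gt0// mulrC bincoef_series_harmonic.
  by rewrite gerBl.
rewrite ltNge; apply/negP => eu; move: hN; rewrite ltNge => /negP; apply.
rewrite ler_pdivlMr// (le_trans _ uN)// mulrC ler_wpM2r//.
by rewrite /series /= sumr_ge0.
Unshelve. all: end_near. Qed.

Definition beta_coef m : R :=
  (m.+1%:R - a)^-1 * \prod_(i < m) (i.+1%:R / (i.+1%:R - a)).

Let ma m : 0 < m.+1%:R - a.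
Proof. by rewrite subr_gt0 (lt_le_trans a1)// ler1n. Qed.

Lemma beta_coefS m : beta_coef m.+1 * (m.+2%:R - a) = m.+1%:R * beta_coef m.
Proof.
rewrite /beta_coef big_ord_recr /= mulrC mulVKf ?gt_eqF//.
by rewrite mulrC -!mulrA; congr (_ * _); rewrite mulrC.
Qed.

(** Recursion of the Beta integral in [m], for partial sums; the last term is a truncation error of
    at most [bincoef a K]. *)
Lemma beta_sumS K m :
  (m.+2%:R - a) * series (fun k => bincoef a k / (k + m.+1 + 1)%:R) K =
  m.+1%:R * series (fun k => bincoef a k / (k + m + 1)%:R) K -
  bincoef a K * (K%:R / (K + m + 1)%:R).
Proof.
elim: K => [|K IHK].
  by rewrite /series /= !big_geq// mul0r !mulr0 subrr.
rewrite !seriesSr !mulrDr IHK.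
have K0 : K.+1%:R != 0 :> R by rewrite pnatr_eq0.
rewrite [bincoef a K.+1 * _]mulrA bincoefS.
have k0 : 0 <= K%:R :> R by []. 
have m0 : 0 <= m%:R :> R by [].
have -> : (K + m.+1 + 1)%:R = K%:R + m%:R + 2 :> R by rewrite -!natrD; congr _%:R; lia.
have -> : (K.+1 + m + 1)%:R = K%:R + m%:R + 2 :> R by rewrite -!natrD; congr _%:R; lia.
have -> : (K + m + 1)%:R = K%:R + m%:R + 1 :> R by rewrite !natrD.
have -> : m.+2%:R = m%:R + 2 :> R by rewrite -!natrD; congr _%:R; lia.
have -> : m.+1%:R = m%:R + 1 :> R by rewrite natr1.
field; apply/andP; split; lra.
Qed.

(* [beta_coef m] is the Beta integral [B(m + 1, 1 - a)]. *)
Lemma beta_sum_cvg m :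
  series (fun k => bincoef a k / (k + m + 1)%:R) @ \oo --> beta_coef m.
Proof.
elim: m => [|m IHm].
  have -> : (fun k => bincoef a k / (k + 0 + 1)%:R) = (fun k => bincoef a k / k.+1%:R).
    by apply/funext => k; rewrite addn0 addn1.
  have -> : series (fun k => bincoef a k / k.+1%:R) =
      (fun n => (1 - a)^-1 * (1 - bincoef a n)).
    by apply/funext => n; rewrite -bincoef_series_harmonic mulKf// gt_eqF// subr_gt0.
  rewrite /beta_coef big_ord0; apply: cvgMl_tmp.
  rewrite -[X in _ --> X]subr0; apply: cvgB; [exact: cvg_cst|exact: bincoef_cvg0].
have -> : series (fun k => bincoef a k / (k + m.+1 + 1)%:R) =
  (fun K => (m.+2%:R - a)^-1 * (m.+1%:R * series (fun k => bincoef a k / (k + m + 1)%:R) K -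
     bincoef a K * (K%:R / (K + m + 1)%:R))).
  by apply/funext => K; rewrite -beta_sumS mulKf// gt_eqF.
have -> : beta_coef m.+1 = (m.+2%:R - a)^-1 * (m.+1%:R * beta_coef m - 0).
  by rewrite -beta_coefS subr0 mulrC mulfK// gt_eqF.
apply: cvgMl_tmp; apply: cvgB; first exact: cvgMl_tmp.
apply: squeeze_cvgr (cvg_cst (0 : R)) bincoef_cvg0.
near=> K; rewrite mulr_ge0 ?bincoef_ge0 ?divr_ge0 ?(ltW a0)//=.
rewrite ler_piMr ?bincoef_ge0 ?(ltW a0)// ler_pdivrMr ?addn1 ?ltr0n// mul1r ler_nat.
by rewrite (leq_trans (leq_addr m _)).
Unshelve. all: end_near. Qed.

(** Partial products of Euler's product for pi a / sin (pi a). *)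
Definition sine_prod m : R :=
  \prod_(i < m) (i.+1%:R ^+ 2 / (i.+1%:R ^+ 2 - a ^+ 2)).

(** With k = i + 1, each factor k / (k - a) splits into (k + a) / k, which builds [bincoef (1 + a)],
    and k^2 / (k^2 - a^2). *)
Lemma beta_coefE m :
  beta_coef m = bincoef (1 + a) m * sine_prod m / (m.+1%:R - a).
Proof.
rewrite /beta_coef mulrC; congr (_ / _).
rewrite /bincoef /sine_prod -big_split /=; apply: eq_bigr => i _.
have h : i.+1%:R + a != 0 by rewrite gt_eqF// addr_gt0.
have i0 : i.+1%:R != 0 :> R by rewrite pnatr_eq0.
have h' : i.+1%:R - a != 0 by rewrite gt_eqF.
rewrite subr_sqr (_ : 1 + a + i%:R = i.+1%:R + a); last by rewrite -natr1; ring.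
by move: (i.+1%:R) h h' i0 => y ? ? ?; field; apply/and3P; split.
Qed.

End BetaSum.

(** * Euler's sine product *)

Section SineProduct.
Context {R : realType}.
Implicit Types (x y t a : R).

Lemma nonneg_derive_le (f df : R -> R) (a b : R) : a <= b ->
  (forall t, is_derive t (1 : R) f (df t)) ->
  (forall t, a <= t <= b -> 0 <= df t) -> f a <= f b.
Proof.
move=> ab fD df0.
have [|c cab fE] := @MVT_segment R f df a b ab (fun t _ => fD t).
  by apply: derivable_within_continuous => t _; have [] := fD t.
by rewrite -subr_ge0 fE mulr_ge0 ?subr_ge0// df0.
Qed.

Lemma is_derive_sin_scale y t :
  is_derive t (1 : R) (fun s => sin (y * s)) (y * cos (y * t)).
Proof.
have D := is_deriveZ y (is_derive_id t (1 : R)).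
have := @is_derive1_comp R sin (y \*: id) t _ _ (is_derive_sin _) D.
by rewrite [y *: 1]mulr1 mulrC.
Qed.

Lemma is_derive_cos_scale y t :
  is_derive t (1 : R) (fun s => cos (y * s)) (- (y * sin (y * t))).
Proof.
have D := is_deriveZ y (is_derive_id t (1 : R)).
have := @is_derive1_comp R cos (y \*: id) t _ _ (is_derive_cos _) D.
by rewrite [y *: 1]mulr1 mulNr mulrC.
Qed.

(** Two integrations by parts of cos^(n+2)(t) cos(y t): the function differentiated is the boundary
    term, linking the exponents n + 2 and n. *)
Lemma is_derive_wallis y n t :
  is_derive t (1 : R)
    (fun s => n.+2%:R * (cos s ^+ n.+1 * sin s * cos (y * s)) -
              y * (cos s ^+ n.+2 * sin (y * s)))
    ((n.+2%:R ^+ 2 - y ^+ 2) * (cos t ^+ n.+2 * cos (y * t)) -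
     n.+2%:R * n.+1%:R * (cos t ^+ n * cos (y * t))).
Proof.
have Dc k := is_deriveX k (is_derive_cos t).
have D1 := is_deriveZ n.+2%:R (is_deriveM (is_deriveM (Dc n.+1) (is_derive_sin t))
  (is_derive_cos_scale y t)).
have D2 := is_deriveZ y (is_deriveM (Dc n.+2) (is_derive_sin_scale y t)).
have -> : (fun s => n.+2%:R * (cos s ^+ n.+1 * sin s * cos (y * s)) -
    y * (cos s ^+ n.+2 * sin (y * s))) =
    n.+2%:R \*: ((cos : R -> R) ^+ n.+1 * sin * (fun s => cos (y * s))) -
    y \*: ((cos : R -> R) ^+ n.+2 * (fun s => sin (y * s))).
  by apply/funext => s; rewrite !fctE.
apply: (is_derive_eq (is_deriveB D1 D2)).
rewrite !fctE /GRing.scale /=.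
have -> : cos t ^+ n.+2 = cos t ^+ n * (1 - sin t ^+ 2).
  by rewrite -cos2sin2 -exprD addn2.
have E : cos t ^+ n.+1 * cos t = cos t ^+ n * (1 - sin t ^+ 2).
  by rewrite -cos2sin2 -exprSr -exprD addn2.
rewrite E -(natr1 n.+1); ring.
Qed.

(* Antiderivatives of [cos^(2n) cos(y t)] vanishing at 0, built from one of
   [cos (y t)] by the recursion of [is_derive_wallis]; the boundary terms of
   the latter vanish at 0 and at [pi / 2]. *)
Lemma wallis_antiderivative y (F0 : R -> R) n : y ^+ 2 < 4 ->
  (forall t, is_derive t (1 : R) F0 (cos (y * t))) -> F0 0 = 0 ->
  exists F : R -> R,
   [/\ forall t, is_derive t (1 : R) F (cos t ^+ n.*2 * cos (y * t)),
      F 0 = 0 &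
      F (pi / 2) = F0 (pi / 2) * \prod_(i < n)
        (i.*2.+2%:R * i.*2.+1%:R / (i.*2.+2%:R ^+ 2 - y ^+ 2))].
Proof.
move=> y2 F0D F00; elim: n => [|n [F [FD F_0 F_pi]]].
  exists F0; split => //; last by rewrite big_ord0 mulr1.
  by move=> t; rewrite expr0 mul1r.
have N0 : n.*2.+2%:R ^+ 2 - y ^+ 2 != 0.
  rewrite gt_eqF// subr_gt0 (lt_le_trans y2)// -natrX ler_nat.
  by rewrite (@leq_exp2r 2 _ 2).
pose B (s : R) : R := n.*2.+2%:R * (cos s ^+ n.*2.+1 * sin s * cos (y * s)) -
              y * (cos s ^+ n.*2.+2 * sin (y * s)).
pose c := (n.*2.+2%:R ^+ 2 - y ^+ 2)^-1.
exists (c \*: ((n.*2.+2%:R * n.*2.+1%:R) \*: F + B)); split.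
- move=> t; have D := is_deriveZ c (is_deriveD
    (is_deriveZ (n.*2.+2%:R * n.*2.+1%:R) (FD t)) (is_derive_wallis y n.*2 t)).
  apply: (is_derive_eq D); rewrite /GRing.scale /= addrC subrK.
  by rewrite /c mulKf.
- by rewrite !fctE /= F_0 /B scaler0 add0r sin0 !mulr0 mul0r sin0 !mulr0 subrr scaler0.
- rewrite big_ord_recr /= !fctE /= /B cos_pihalf !expr0n /= !mul0r !mulr0 subrr addr0.
  by rewrite F_pi /GRing.scale /= /c; ring.
Qed.

Lemma x_cos_le_sin t : 0 <= t <= pi -> t * cos t <= sin t.
Proof.
move=> /andP[t0 tpi].
pose f (s : R) : R := sin s - s * cos s.
have fD s : is_derive s (1 : R) f (s * sin s).
  have := is_deriveB (is_derive_sin s) (is_deriveM (is_derive_id s (1 : R)) (is_derive_cos s)).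
  by move=> D; apply: (is_derive_eq D); rewrite /GRing.scale /=; ring.
have := @nonneg_derive_le f (fun s => s * sin s) 0 t t0 fD.
rewrite /f sin0 mul0r subrr subr_ge0; apply => s /andP[s0 st].
by rewrite mulr_ge0// sin_ge0_pi// s0 (le_trans st).
Qed.

Lemma sin_sqr_le (u : R) : sin u ^+ 2 <= u ^+ 2.
Proof.
wlog u0 : u / 0 <= u.
  move=> H; have [/H//|u0] := leP 0 u.
  by rewrite -sqrrN -sinN -(sqrrN u) H// oppr_ge0 ltW.
have hD (e : R) s : is_derive s (1 : R) (fun s : R => s + e * sin s) (1 + e * cos s).
  exact: is_deriveD (is_derive_id s (1 : R)) (is_deriveZ e (is_derive_sin s)).
(* The cases e = 1 and e = -1 multiply to u^2 - sin(u)^2 >= 0. *)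
have H (e : R) : `|e| <= 1 -> 0 <= u + e * sin u.
  move=> e1; have := @nonneg_derive_le _ _ 0 u u0 (hD e).
  rewrite sin0 mulr0 addr0; apply => s _.
  have : `|e * cos s| <= 1 by rewrite normrM mulr_ile1// cos_max.
  by rewrite ler_norml => /andP[]; lra.
have := H 1; have := H (-1); rewrite normrN normr1 lexx => /(_ isT) h1 /(_ isT) h2.
by nra.
Qed.

(* Compares the antiderivatives for [y = 2 a] and [y = 0] using
   [1 - cos (2 a t) = 2 sin(a t)^2 <= 2 a^2 t^2] and [t cos t <= sin t]. *)
Lemma sine_prod_ge a m : 0 < a < 1 ->
  pi * a * (1 - 2 * a ^+ 2 / m.*2.+1%:R) <= @sine_prod R a m.+1 * sin (pi * a).
Proof.
move=> /andP[a0 a1].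
have y2 : (2 * a) ^+ 2 < 4 :> R by nra.
have z2 : (0 : R) ^+ 2 < 4 by rewrite expr0n.
pose S (t : R) : R := (2 * a)^-1 * sin (2 * a * t).
have SD t : is_derive t (1 : R) S (cos (2 * a * t)).
  have D := is_deriveZ (2 * a)^-1 (is_derive_sin_scale (2 * a) t).
  apply: (is_derive_eq D); rewrite /GRing.scale /= mulKf// mulf_neq0// gt_eqF//.
have S0 : S 0 = 0 by rewrite /S mulr0 sin0 mulr0.
have ID t : is_derive t (1 : R) (id : R -> R) (cos (0 * t)).
  by rewrite mul0r cos0; exact: is_derive_id.
have [F [FD F_0 F_pi]] := wallis_antiderivative _ _ m.+1 y2 SD S0.
have [G [GD G_0 G_pi]] := wallis_antiderivative _ _ m.+1 z2 ID erefl.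
have [H [HD H_0 H_pi]] := wallis_antiderivative _ _ m z2 ID erefl.
(* The derivative of [K] is cos^(2m)(t) times cos(t)^2 (cos(2 a t) - 1) + 2 a^2 sin(t)^2,
   nonnegative on [0, pi / 2]; the claim is a rescaling of K(pi / 2) >= 0. *)
pose K := F - G + (2 * a ^+ 2) \*: (H - G).
have p2 : 0 <= pi / 2 :> R by rewrite divr_ge0// pi_ge0.
have KD t := is_deriveD (is_deriveB (FD t) (GD t))
  (is_deriveZ (2 * a ^+ 2) (is_deriveB (HD t) (GD t))).
have := @nonneg_derive_le K _ 0 (pi / 2) p2 KD.
have KE t : K t = F t - G t + 2 * a ^+ 2 * (H t - G t) by [].
rewrite !KE F_0 G_0 H_0 subrr mulr0 addr0 F_pi G_pi H_pi => Kpi.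
have {Kpi} := Kpi _; set P0 := \prod_(i < m) _; set Pa := \prod_(i < m.+1) _.
set P1 := \prod_(i < m.+1) _ => Kpi.
have P1E : P1 * m.*2.+2%:R = P0 * m.*2.+1%:R.
  rewrite /P1 big_ord_recr /= -/P0 expr0n subr0.
  have : m.*2.+2%:R != 0 :> R by rewrite pnatr_eq0.
  by move: (m.*2.+2%:R) => k k0; field.
have P0_gt0 : 0 < P0.
  by apply: prodr_gt0 => i _; rewrite expr0n subr0 divr_gt0 ?mulr_gt0.
have P1_gt0 : 0 < P1 by rewrite -(pmulr_lgt0 _ (_ : 0 < m.*2.+2%:R)) ?ltr0n// P1E mulr_gt0.
(* As (2i + 2)^2 - (2a)^2 = 4 ((i + 1)^2 - a^2), dividing by the product for y = 0 leaves
   Euler's. *)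
have PaE : Pa = P1 * @sine_prod R a m.+1.
  rewrite /Pa /P1 /sine_prod -big_split /=; apply: eq_bigr => i _.
  have i1 : 1 <= i.+1%:R :> R by rewrite ler1n.
  have -> : i.*2.+2%:R = 2 * i.+1%:R :> R by rewrite -natrM; congr _%:R; lia.
  move: (i.+1%:R) i1 => k k1; field.
  apply/and3P; split; nra.
have {Kpi} : 0 <= (2 * a)^-1 * sin (2 * a * (pi / 2)) * Pa - pi / 2 * P1 +
    2 * a ^+ 2 * (pi / 2 * P0 - pi / 2 * P1).
  apply: Kpi => t /andP[t0 tpi].
  rewrite mul0r cos0 !mulr1 /GRing.scale /= doubleS.
  have -> : cos t ^+ m.*2.+2 = cos t ^+ m.*2 * cos t ^+ 2 by rewrite -exprD addn2.
  have -> : cos (2 * a * t) = 1 - 2 * sin (a * t) ^+ 2.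
    by rewrite -mulrA mulrC mulr_natr cos_mulr2n cos2sin2; ring.
  have c0 : 0 <= cos t ^+ m.*2 by rewrite exprn_even_ge0// odd_double.
  have ct : 0 <= cos t by rewrite cos_ge0_pihalf// tpi andbT (le_trans _ t0)// oppr_le0.
  have tc : t * cos t <= sin t.
    apply: x_cos_le_sin; rewrite t0 (le_trans tpi)// ler_pdivrMr//.
    by rewrite ler_peMr ?pi_ge0// ler1n.
  have tc2 : (t * cos t) ^+ 2 <= 1 - cos t ^+ 2.
    by rewrite -sin2cos2 lerXn2r ?nnegrE ?mulr_ge0//; apply: le_trans tc; rewrite mulr_ge0.
  have sa := sin_sqr_le (a * t).
  have h : sin (a * t) ^+ 2 * cos t ^+ 2 <= a ^+ 2 * (1 - cos t ^+ 2).
    apply: (@le_trans _ _ ((a * t) ^+ 2 * cos t ^+ 2)).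
      by rewrite ler_wpM2r ?sqr_ge0.
    by rewrite exprMn -mulrA -exprMn ler_wpM2l ?sqr_ge0.
  have -> : forall C c s : R, C * c * (1 - 2 * s) - C * c + 2 * a ^+ 2 * (C - C * c) =
    2 * C * (a ^+ 2 * (1 - c) - s * c) by move=> *; ring.
  by rewrite mulr_ge0 ?mulr_ge0// subr_ge0.
(* P0 - P1 = P1 / (2 m + 1) produces the error term of the statement. *)
have -> : P0 = P1 * m.*2.+2%:R / m.*2.+1%:R by rewrite P1E mulfK// pnatr_eq0.
have -> : 2 * a * (pi / 2) = pi * a by field.
rewrite PaE.
have -> : (2 * a)^-1 * sin (pi * a) * (P1 * @sine_prod R a m.+1) - pi / 2 * P1 +
    2 * a ^+ 2 * (pi / 2 * (P1 * m.*2.+2%:R / m.*2.+1%:R) - pi / 2 * P1) =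
    P1 / (2 * a) * (@sine_prod R a m.+1 * sin (pi * a) -
     pi * a * (1 - 2 * a ^+ 2 / m.*2.+1%:R)).
  have : m.*2.+1%:R != 0 :> R by rewrite pnatr_eq0.
  rewrite -(natr1 m.*2.+1); move: (m.*2.+1%:R) => k k0; field.
  by rewrite k0 gt_eqF.
by rewrite pmulr_rge0 ?subr_ge0// divr_gt0// mulr_gt0.
Qed.

End SineProduct.

(** * The lower bound *)

Section LowerBound.
Context {R : realType} {a : R}.
Hypothesis a01 : 0 < a < 1.

Let a0 : 0 < a. Proof. by case/andP: a01. Qed.
Let a1 : a < 1. Proof. by case/andP: a01. Qed.
Let u0 k : 0 <= bincoef a k. Proof. by rewrite bincoef_ge0// ltW. Qed.

(** Coefficients of the derivative of (1 - x)^(-b), which is b (1 - x)^(-1-b). *)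
Lemma bincoef_shift (b : R) k :
  bincoef b k.+1 * k.+1%:R = b * bincoef (1 + b) k.
Proof.
elim: k => [|k IHk]; first by rewrite bincoefS !bincoef0 mul1r mulr1 addr0.
have k0 : k.+1%:R != 0 :> R by rewrite pnatr_eq0.
apply: (mulIf k0); rewrite bincoefS mulrAC IHk -[RHS]mulrA bincoefS -(natr1 k).
ring.
Qed.

Lemma series_double (u : R^nat) n :
  series u n.*2 = series (fun j => u j.*2 + u j.*2.+1) n.
Proof.
elim: n => [|n IHn]; first by rewrite /series /= !big_geq.
by rewrite doubleS !seriesSr IHn addrA.
Qed.

(* The Taylor coefficients of [((1 - z^2)^(-a) - 1) / (2 a)], whose derivative
   is [z (1 - z^2)^(-1-a)]. *)
Definition test_coef k : R :=
  if odd k || (k == 0)%N then 0 else bincoef a k./2 / (2 * a).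

Lemma test_coef_ge0 k : 0 <= test_coef k.
Proof. by rewrite /test_coef; case: ifP => // _; rewrite divr_ge0// mulr_ge0// ltW. Qed.

Lemma test_coef_odd j : test_coef j.*2.+1 = 0.
Proof. by rewrite /test_coef /= odd_double. Qed.

Lemma test_coef_even j : test_coef j.+1.*2 = bincoef a j.+1 / (2 * a).
Proof. by rewrite /test_coef odd_double doubleK. Qed.

(** The summand j = 0, removed by the -1 in the test function, is restored and subtracted. *)
Lemma test_coef_series K n :
  series (fun k => test_coef k / (n + k + 1)%:R) K.+1.*2 =
  (2 * a)^-1 * (series (fun j => bincoef a j / (n + j.*2 + 1)%:R) K.+1 -
                (n + 1)%:R^-1).
Proof.
rewrite series_double; elim: K => [|K IHK].
  rewrite !(seriesSr _ 0) /series /= !big_geq// !add0r mul0r mul0r addr0.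
  by rewrite bincoef0 mul1r addn0 subrr mulr0.
rewrite seriesSr IHK test_coef_odd mul0r addr0 test_coef_even.
by rewrite [in RHS]seriesSr; ring.
Qed.

Lemma test_coef_cvg : cvgn (series (fun k => test_coef k / (0 + k + 1)%:R)).
Proof.
have t0 k : 0 <= test_coef k / (0 + k + 1)%:R by rewrite divr_ge0// test_coef_ge0.
apply: (bounded_nonneg_series_cvg _ ((2 * a)^-1 * (1 - a)^-1)) => // n.
apply: (@le_trans _ _ (series (fun k => test_coef k / (0 + k + 1)%:R) n.+1.*2)).
  apply: nondecreasing_series => [k _ _|]; first exact: t0.
  by lia.
rewrite test_coef_series ler_wpM2l ?invr_ge0 ?mulr_ge0 ?(ltW a0)//.
apply: (@le_trans _ _ (series (fun k => bincoef a k / k.+1%:R) n.+1)).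
  rewrite lerBlDr ler_wpDr// /series /=; apply: ler_sum => i _.
  rewrite ler_wpM2l// lef_pV2 ?posrE ?ltr0n ?addn1// ler_nat; lia.
rewrite -[leRHS]mul1r ler_pdivlMr ?subr_gt0// mulrC bincoef_series_harmonic.
by rewrite gerBl.
Qed.

(** By [bincoef_shift], the term of index 2 i + 2 is r times the i-th term of the series of (1 -
    x)^(-1-a) at x = r^2, and r <= 1. *)
Lemma test_coef_norm (r : R) n : 0 <= r < 1 ->
  test_coef 0%N + (1 - r ^+ 2) `^ (1 + a) *
    series (fun k => test_coef k * (k%:R * r ^+ k.-1)) n <= 1.
Proof.
move=> /andP[r0 r1].
have r2 : 0 <= r ^+ 2 < 1 by rewrite sqr_ge0 expr_lt1.
have w0 : 0 < (1 - r ^+ 2) `^ (1 + a) by rewrite powR_gt0// subr_gt0; case/andP: r2.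
have t0 k : 0 <= test_coef k * (k%:R * r ^+ k.-1).
  by rewrite !mulr_ge0 ?exprn_ge0 ?test_coef_ge0.
rewrite {1}/test_coef add0r mulrC -ler_pdivlMr// mul1r -powRN.
apply: (@le_trans _ _ (series (fun k => test_coef k * (k%:R * r ^+ k.-1)) n.+1.*2)).
  by apply: nondecreasing_series => [k _ _|]; [exact: t0|lia].
rewrite series_double.
apply: le_trans (bincoef_series_le (1 + a) _ n _ r2); last by rewrite addr_ge0// ltW.
rewrite /series /= big_nat_recl// (test_coef_odd 0) -[0.*2]/0%N.
rewrite [test_coef 0]/test_coef !mul0r !add0r.
apply: ler_sum => i _; rewrite test_coef_odd mul0r addr0 test_coef_even.
have -> : bincoef a i.+1 / (2 * a) * (i.+1.*2%:R * r ^+ i.+1.*2.-1) =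
    bincoef (1 + a) i * (r ^+ 2) ^+ i * r.
  rewrite -exprM -[in RHS]mulrA -exprSr mul2n doubleS /=.
  have -> : i.*2.+2%:R = 2 * i.+1%:R :> R by rewrite -natrM; congr _%:R; lia.
  have := bincoef_shift a i.
  move: (bincoef a i.+1) (bincoef (1 + a) i) (i.+1%:R) => x y k.
  have -> : x / (2 * a) * (2 * k * r ^+ i.*2.+1) = (x * k) / a * r ^+ i.*2.+1.
    by field; rewrite gt_eqF.
  by move=> ->; field; rewrite gt_eqF.
by rewrite ler_piMr// ?(ltW r1)// mulr_ge0 ?exprn_ge0 ?sqr_ge0// bincoef_ge0// addr_ge0// ltW.
Qed.

(** Since n + 2 j + 1 <= 2 (j + n./2 + 1), the sum over even indices is at least half a Beta sum. *)
Lemma test_hilbert_coef_ge n :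
  (2 * a)^-1 * (@beta_coef R a n./2 / 2 - (n + 1)%:R^-1) <=
  hilbert_coef test_coef n.
Proof.
have a20 : 0 < 2 * a by rewrite mulr_gt0.
rewrite ler_pdivrMl// lerBlDr ler_pdivrMr//.
have bc := beta_sum_cvg a01 n./2.
rewrite -(cvg_lim (@norm_hausdorff _ R) bc).
apply: limn_le => [|K]; first exact: (cvgP _ bc).
rewrite -ler_pdivrMr// -lerBlDr -ler_pdivrMl//.
apply: le_trans (hilbert_coef_ge _ n K.+1.*2 test_coef_ge0 test_coef_cvg).
rewrite test_coef_series ler_wpM2l ?invr_ge0 ?(ltW a20)// lerD2r.
apply: (@le_trans _ _ (series (fun k => bincoef a k / (n + k.*2 + 1)%:R) K)).
  rewrite /series /= mulr_suml; apply: ler_sum => i _.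
  rewrite -mulrA -invfM ler_wpM2l// lef_pV2 ?posrE ?mulr_gt0 ?ltr0n ?addn1//.
  by rewrite -natrM ler_nat; lia.
by apply: nondecreasing_series => // k _ _; rewrite divr_ge0.
Qed.

Lemma beta_coef_ge0 m : 0 <= @beta_coef R a m.
Proof.
have ma k : 0 <= k.+1%:R - a by rewrite subr_ge0 (le_trans (ltW a1))// ler1n.
by rewrite /beta_coef mulr_ge0 ?invr_ge0 ?prodr_ge0// => i _; rewrite divr_ge0.
Qed.

(** Take r^2 = 1 - s. The indices k = 2 m and 2 m + 1 are both bounded through [beta_coef m], with
    powers r^(k-1) >= (1 - s)^m, so each pair contributes twice (2 a)^(-1). *)
Lemma test_opnorm_ge (L : R) : (hilbert_bloch_opnorm (1 + a) <= L%:E)%E ->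
  forall (s : R) N, 0 < s <= 1 ->
  hilbert_coef test_coef 0 + s `^ (1 + a) * (a^-1 *
    series (fun m => (m%:R * @beta_coef R a m - 1) * (1 - s) ^+ m) N) <= L.
Proof.
move=> HL s N /andP[s0 s1].
pose r := Num.sqrt (1 - s).
have r0 : 0 <= r := sqrtr_ge0 _.
have r2 : r ^+ 2 = 1 - s by rewrite sqr_sqrtr ?subr_ge0.
have r1 : r < 1 by rewrite -(@ltr_pXn2r _ 2) ?nnegrE// expr1n r2 gtrBl.
have r01 : 0 <= r < 1 by rewrite r0.
have h0 n : 0 <= hilbert_coef test_coef n.
  apply: le_trans (hilbert_coef_ge _ n 0 test_coef_ge0 test_coef_cvg).
  by rewrite /series /= big_geq.
have := le_trans (hilbert_opnorm_ge _ _ test_coef_ge0 test_coef_cvg test_coef_norm _ N.*2 r01) HL.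
rewrite lee_fin r2 subKr; apply: le_trans; rewrite lerD2l ler_wpM2l ?powR_ge0//.
have nh n : (2 * a)^-1 * (n./2%:R * @beta_coef R a n./2 - 1) <=
    n%:R * hilbert_coef test_coef n.
  apply: le_trans (ler_wpM2l (ler0n _ n) (test_hilbert_coef_ge n)).
  have := beta_coef_ge0 n./2; move: (@beta_coef R a n./2) => B B0.
  rewrite [leRHS]mulrCA ler_wpM2l ?invr_ge0 ?mulr_ge0 ?(ltW a0)//.
  rewrite mulrBr lerB//; last by rewrite ler_pdivrMr ?addn1 ?ltr0n// mul1r ler_nat.
  rewrite mulrCA mulrC ler_wpM2l// ler_pdivlMr// -natrM ler_nat; lia.
rewrite series_double /series /= mulr_sumr; apply: ler_sum => m _.
set c := m%:R * @beta_coef R a m - 1.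
have rm k : (k <= m.*2)%N -> (1 - s) ^+ m <= r ^+ k.
  move=> km; rewrite -r2 -exprM mul2n.
  by rewrite ler_wiXn2l// ltW.
have rm0 : 0 <= (1 - s) ^+ m by rewrite exprn_ge0// subr_ge0.
(* [c] may be negative, so it is replaced by the nonnegative [k%:R * hilbert_coef test_coef k]
   before the power is enlarged. *)
have step k : k./2 = m -> (2 * a)^-1 * c * (1 - s) ^+ m <=
    hilbert_coef test_coef k * (k%:R * r ^+ k.-1).
  move=> km; apply: (@le_trans _ _ (k%:R * hilbert_coef test_coef k * (1 - s) ^+ m)).
    by rewrite ler_wpM2r// /c -km.
  by rewrite [leRHS]mulrA [in leRHS](mulrC (hilbert_coef _ _)) ler_wpM2l ?mulr_ge0// rm//; lia.
have -> : a^-1 * (c * (1 - s) ^+ m) =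
    (2 * a)^-1 * c * (1 - s) ^+ m + (2 * a)^-1 * c * (1 - s) ^+ m.
  by field; rewrite gt_eqF.
by rewrite lerD// step//= ?doubleK// uphalf_double.
Qed.

Let sin_gt0 : 0 < sin (pi * a).
Proof. by rewrite sin_gt0_pi// mulr_gt0 ?pi_gt0//= gtr_pMr ?pi_gt0. Qed.

(** The sine product loses a factor 1 - 2/m and the quotient m / (m + 1 - a) a factor 1 - 1/m,
    together at least 1 - 3/m; both factors are nonnegative for m >= 2. *)
Lemma beta_coef_ge m : (2 <= m)%N ->
  pi * a / sin (pi * a) * (1 - 3 / m%:R) * bincoef (1 + a) m <=
  m%:R * @beta_coef R a m.
Proof.
case: m => // m m2; rewrite (beta_coefE a01).
set T := pi * a / _; set d := bincoef _ _; set P := @sine_prod R a _.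
have d0 : 0 <= d by rewrite bincoef_ge0// addr_ge0// ltW.
have T0 : 0 <= T by rewrite divr_ge0 ?mulr_ge0 ?pi_ge0// ltW.
set k : R := m.+1%:R; have k2 : 2 <= k by rewrite /k ler_nat.
have PT : T * (1 - 2 / k) <= P.
  rewrite /T mulrAC ler_pdivrMr//; apply: le_trans (sine_prod_ge _ m a01).
  rewrite ler_wpM2l ?mulr_ge0 ?pi_ge0 ?(ltW a0)// lerD2l lerN2.
  rewrite ler_pM ?invr_ge0 ?mulr_ge0 ?sqr_ge0 ?(ltW a0)//.
    by rewrite ler_piMr// expr_le1// ltW.
  rewrite lef_pV2 ?posrE ?ltr0n// ler_nat; lia.
have a0_ : 0 < a := a0; have a1_ : a < 1 := a1.
have kk : 1 - k^-1 <= k / (m.+2%:R - a).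
  rewrite -(natr1 m.+1) -/k ler_pdivlMr; last lra.
  rewrite mulrBl mul1r lerBlDr -lerBlDl.
  rewrite ler_pdivlMl; last lra.
  nra.
have -> : k * (d * P / (m.+2%:R - a)) = P * (k / (m.+2%:R - a)) * d by ring.
rewrite ler_wpM2r//.
have ki : 0 <= k^-1 by rewrite invr_ge0; lra.
have ki2 : k^-1 <= 2^-1 by rewrite lef_pV2// posrE; lra.
apply: (@le_trans _ _ (T * (1 - 2 / k) * (1 - k^-1))).
  by rewrite -mulrA ler_wpM2l//; have := sqr_ge0 k^-1; move: (k^-1) => x; nra.
have [k1 k1'] : 0 <= 1 - 2 / k /\ 0 <= 1 - k^-1.
  by move: (k^-1) ki ki2 => x ? ?; split; lra.
by rewrite ler_pM// mulr_ge0.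
Qed.

(** An Abelian argument: for large m, m B_m dominates [th] times the coefficient of (1 - x)^(-1-a),
    whose sum at x = 1 - s is s^(-1-a). Multiplying by s^(1+a) and letting s tend to 0 removes the
    errors. *)
Lemma opnorm_limit_ge (L : R) : (hilbert_bloch_opnorm (1 + a) <= L%:E)%E ->
  hilbert_coef test_coef 0 + pi / sin (pi * a) <= L.
Proof.
move=> HL; set b0 := hilbert_coef _ _.
apply/ler_addgt0Pr => e e0.
pose T := pi * a / sin (pi * a).
have T0 : 0 < T by rewrite divr_gt0 ?mulr_gt0 ?pi_gt0.
(* The deficit a e becomes [e] after division by [a]. *)
pose th := T - a * e.
(* From [M] on, the loss 3 T / m is at most a e. *)
pose M := (Num.truncn (3 * T / (a * e))).+2.
have thM m : (M <= m)%N -> th * bincoef (1 + a) m <= m%:R * @beta_coef R a m.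
  move=> Mm; have m2 : (2 <= m)%N by rewrite (leq_trans _ Mm).
  apply: le_trans (beta_coef_ge m m2).
  rewrite ler_wpM2r ?bincoef_ge0 ?addr_ge0 ?(ltW a0)// -/T /th mulrBr mulr1.
  rewrite lerD2l lerN2 mulrA ler_pdivrMr ?ltr0n; last by lia.
  rewrite -ler_pdivrMl ?mulr_gt0// [leLHS]mulrC (mulrC T).
  by apply: le_trans (ltW (truncnS_gt _)) _; rewrite ler_nat ltnW.
(* Bounds the contribution of the indices below [M], uniformly in [s] and [N]. *)
pose C := series (fun m => `|th| * bincoef (1 + a) m + m%:R * `|@beta_coef R a m|) M.
have key (s : R) : 0 < s <= 1 -> th - C * s `^ (1 + a) - s `^ a <= (L - b0) * a.
  move=> s01; have /andP[s0 s1] := s01.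
  have r01 : 0 <= 1 - s < 1 by rewrite subr_ge0 s1 gtrBl.
  have w0 : 0 < s `^ (1 + a) by exact: powR_gt0.
  have bound N : th * series (fun m => bincoef (1 + a) m * (1 - s) ^+ m) N <=
      (L - b0) * a / s `^ (1 + a) + C + s^-1.
    have H := test_opnorm_ge _ HL s N s01.
    have {H} : series (fun m => (m%:R * @beta_coef R a m - 1) * (1 - s) ^+ m) N <=
        (L - b0) * a / s `^ (1 + a).
      rewrite ler_pdivlMr// -ler_pdivrMr// lerBrDl; apply: le_trans _ H.
      by rewrite lerD2l le_eqVlt; apply/orP; left; apply/eqP; ring.
    have geo : series (fun m => (1 - s) ^+ m) N <= s^-1.
      have -> : series (fun m => (1 - s) ^+ m) N = (1 - (1 - s) ^+ N) / s.
        have := @geometric_seriesE R 1 (1 - s).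
        rewrite lt_eqF ?gtrBl// => /(_ isT) /(congr1 (@^~ N)) /=.
        rewrite mul1r subKr => <-; congr (series _ N).
        by apply/funext => m; rewrite /geometric /= mul1r.
      by rewrite ler_pdivrMr// mulVf ?gt_eqF// gerBl exprn_ge0// subr_ge0.
    have CN : series (fun m => (th * bincoef (1 + a) m - m%:R * @beta_coef R a m) * (1 - s) ^+ m) N <= C.
      set t := fun m : nat => _; pose c m := `|th| * bincoef (1 + a) m + m%:R * `|@beta_coef R a m|.
      have d0 m : 0 <= bincoef (1 + a) m by rewrite bincoef_ge0// addr_ge0// ltW.
      have c0 m : 0 <= c m by rewrite addr_ge0// mulr_ge0.
      have sm m : 0 <= (1 - s) ^+ m <= 1.
        by rewrite exprn_ge0 ?subr_ge0// exprn_ile1 ?subr_ge0// gerBl ltW.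
      have tc m : t m <= c m.
        rewrite /t /c; have /andP[e0' e1] := sm m.
        apply: le_trans (ler_norm _) _; rewrite normrM (ger0_norm e0').
        apply: (@le_trans _ _ `|th * bincoef (1 + a) m - m%:R * @beta_coef R a m|).
          by rewrite ler_piMr.
        rewrite (le_trans (ler_normB _ _))// !normrM (ger0_norm (d0 m)) normr_nat.
        exact: lexx.
      have tM m : (M <= m)%N -> t m <= 0.
        move=> Mm; rewrite /t mulr_le0_ge0// ?subr_le0 ?thM//.
        by case/andP: (sm m).
      (* Terms from index [M] on are nonpositive, so the bound stops growing there. *)
      apply: (@le_trans _ _ (series c (minn N M))); last first.
        by apply: nondecreasing_series => [m _ _|]; [exact: c0|exact: geq_minr].
      elim: (N) => [|n IHn]; first by rewrite /series /= min0n !big_geq.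
      rewrite seriesSr; case: (ltnP n M) => nM.
        rewrite (minn_idPl nM) seriesSr lerD//.
        by rewrite (minn_idPl (ltnW nM)) in IHn.
      rewrite (minn_idPr nM) in IHn; rewrite (minn_idPr (leqW nM)).
      by rewrite -[leRHS]addr0 lerD// tM.
    (* The three pieces are bounded by [C], by the operator norm and by the geometric sum. *)
    have : th * series (fun m => bincoef (1 + a) m * (1 - s) ^+ m) N =
      series (fun m => (th * bincoef (1 + a) m - m%:R * @beta_coef R a m) * (1 - s) ^+ m) N
      + series (fun m => (m%:R * @beta_coef R a m - 1) * (1 - s) ^+ m) N
      + series (fun m => (1 - s) ^+ m) N.
      by rewrite /series /= mulr_sumr -!big_split /=; apply: eq_bigr => m _; ring.
    lra.
  have r01a : 0 <= 1 + a by rewrite addr_ge0// ltW.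
  have cS : (fun N => th * series (fun m => bincoef (1 + a) m * (1 - s) ^+ m) N) @ \oo
      --> th * (1 - (1 - s)) `^ (- (1 + a)).
    exact: cvgMl_tmp (bincoef_series_cvg _ _ r01a r01).
  have : th * (1 - (1 - s)) `^ (- (1 + a)) <= (L - b0) * a / s `^ (1 + a) + C + s^-1.
    rewrite -(cvg_lim (@norm_hausdorff _ R) cS).
    by apply: limn_le; [exact: (cvgP _ cS)|exact: bound].
  rewrite subKr powRN -(ler_pM2r w0) divfK ?gt_eqF// => H.
  have wE : s `^ (1 + a) = s * s `^ a.
    by rewrite powRD ?powRr1 ?(ltW s0)// (gt_eqF s0) implybT.
  have : ((L - b0) * a / s `^ (1 + a) + C + s^-1) * s `^ (1 + a) =
      (L - b0) * a + C * s `^ (1 + a) + s `^ a.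
    rewrite wE; move: (s `^ a) (powR_gt0 a s0) => p p0; field.
    by rewrite !gt_eqF.
  lra.
have lim_th : (fun s : R => th - C * s `^ (1 + a) - s `^ a) @ (0 : R)^'+ --> th.
  rewrite -[X in _ --> X]subr0 -[X in _ --> X - _]subr0 -[X in _ --> _ - X - _](mulr0 C).
  apply: cvgB; last exact: powR_cvg0.
  apply: cvgB; first exact: cvg_cst.
  by apply: cvgMl_tmp; apply: powR_cvg0; rewrite addr_gt0.
have : th <= (L - b0) * a.
  rewrite -(cvg_lim (@norm_hausdorff _ R) lim_th).
  apply: limr_le; first exact: (cvgP _ lim_th).
  near=> s; apply: key; apply/andP; split.
    by near: s; exact: nbhs_right_gt.
  by near: s; apply: nbhs_right_le.
rewrite /th /T.
have -> : pi * a / sin (pi * a) - a * e = (pi / sin (pi * a) - e) * a by ring.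
rewrite ler_pM2r//; lra.
Unshelve. all: end_near. Qed.

(** * The integral and the value of the image at 0 *)

Lemma integral_exprn n :
  (\int[lebesgue_measure]_(t in `[0%R, 1%R]) (t ^+ n)%:E = (n.+1%:R^-1 : R)%:E)%E.
Proof.
pose F (t : R) : R := n.+1%:R^-1 * t ^+ n.+1.
have FD t : is_derive t (1 : R) F (t ^+ n).
  have D := is_deriveZ n.+1%:R^-1 (is_deriveX n.+1 (is_derive_id t (1 : R))).
  have -> : F = n.+1%:R^-1 \*: (id : R -> R) ^+ n.+1.
    by apply/funext => x; rewrite /F /= exprfctE.
  apply: (is_derive_eq D); rewrite /GRing.scale /= mulr1 mulKf// pnatr_eq0//.
have Fc : continuous F.
  by move=> t; apply: differentiable_continuous; apply/derivable1_diffP; have [] := FD t.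
rewrite (@continuous_FTC2 _ _ F)//.
- by rewrite -EFinB /F expr1n expr0n mulr1 mulr0 subr0.
- by apply: continuous_subspaceT => t; exact: exprn_continuous.
- split => [t _||]; [by have [] := FD t|apply: cvg_at_right_filter|apply: cvg_at_left_filter]; exact: Fc.
- by move=> t _; rewrite derive1E; have [_ ->] := FD t.
Qed.

(** Termwise integration of the binomial series: t^(2k) integrates to 1 / (2k + 1), the term k = 0
    gives (2 a)^(-1), and the others add up to at most (H f)(0). *)
Lemma test_integral_le :
  (\int[lebesgue_measure]_(t in `[0%R, 1%R])
        ((1 - t ^+ 2) `^ (- a) / (2 * a))%:E <=
   (hilbert_coef test_coef 0 + (2 * a)^-1)%:E)%E.
Proof.
have a20 : 0 < 2 * a by rewrite mulr_gt0.
pose f k (t : R) : \bar R := (bincoef a k / (2 * a) * t ^+ k.*2)%:E.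
have f0 k t : (0 <= f k t)%E.
  rewrite lee_fin mulr_ge0 ?divr_ge0 ?(ltW a20)//.
  by rewrite exprn_even_ge0// odd_double.
have mf (k : nat) : measurable_fun (`[0%R, 1%R]%classic : set R) (f k).
  apply/measurable_EFinP; apply: measurable_funM; first exact: measurable_cst.
  exact: exprn_measurable.
have intf k : (\int[lebesgue_measure]_(t in `[0%R, 1%R]) f k t =
    (bincoef a k / (2 * a) / k.*2.+1%:R)%:E)%E.
  rewrite /f; under eq_integral do rewrite EFinM.
  rewrite ge0_integralZl//=.
  - by rewrite integral_exprn EFinM.
  - apply/measurable_EFinP; exact: exprn_measurable.
  - by move=> t; rewrite /= in_itv /= => /andP[t0 _]; rewrite lee_fin exprn_ge0.
  - by rewrite lee_fin divr_ge0// ltW.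
apply: (@le_trans _ _ (\int[lebesgue_measure]_(t in `[0%R, 1%R])
    (\sum_(0 <= k <oo) f k t))%E).
  apply: ge0_le_integral => //.
  - by move=> t _; rewrite lee_fin divr_ge0 ?powR_ge0// ltW.
  - apply/measurable_EFinP; apply: measurable_funM => //.
    apply: (measurableT_comp (measurable_powR _)).
    by apply: measurable_funB => //; exact: exprn_measurable.
  - by apply: ge0_emeasurable_sum => [k t _ _|k _]; [exact: f0|exact: mf].
  move=> t; rewrite /= in_itv /= => /andP[t0]; rewrite le_eqVlt => /predU1P[->|t1].
    (* At t = 1 the integrand is 0, since [powR] sends base 0 to 0 for a nonzero exponent. *)
    rewrite expr1n subrr powR0 ?oppr_eq0 ?gt_eqF// mul0r.
    by apply: nneseries_ge0 => k _ _; exact: f0.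
  have t2 : 0 <= t ^+ 2 < 1 by rewrite sqr_ge0 expr_lt1.
  have c := bincoef_series_cvg _ _ (ltW a0) t2.
  have c' : (fun n => series (fun k => bincoef a k * (t ^+ 2) ^+ k) n / (2 * a)) @ \oo
      --> (1 - t ^+ 2) `^ (- a) / (2 * a) by exact: cvgMr_tmp c.
  rewrite -(cvg_lim (@norm_hausdorff _ R) c') -EFin_lim; last exact: (cvgP _ c').
  apply: lime_le.
    by apply: (cvgP _ (cvg_EFin _ c')); exact: nearW.
  apply: nearW => n; apply: le_trans (nneseries_lim_ge n (fun k _ _ => f0 k t)).
  rewrite sumEFin lee_fin /series /= mulr_suml; apply: ler_sum => k _.
  by rewrite -exprM mul2n mulrAC.
rewrite integral_nneseries//; under eq_eseriesr do rewrite intf.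
apply: lime_le.
  apply: is_cvg_nneseries => k _ _; rewrite lee_fin !divr_ge0//; exact: ltW.
apply: nearW => K; rewrite sumEFin lee_fin.
rewrite -lerBlDr; apply: le_trans (hilbert_coef_ge _ 0 K.+1.*2 test_coef_ge0 test_coef_cvg).
rewrite test_coef_series mulrBr add0n invr1 mulr1 lerD2r /series /= mulr_sumr.
rewrite big_nat_recr//=; apply: ler_wpDr.
  by rewrite mulr_ge0 ?invr_ge0 ?divr_ge0 ?(ltW a20).
apply: ler_sum => i _; rewrite le_eqVlt; apply/orP; left; apply/eqP.
by rewrite add0n addn1 mulrAC mulrC.
Qed.

End LowerBound.

Theorem theorem5p1 (R : realType) :
  (forall alpha : R, 1 < alpha < 2 ->
     (\int[lebesgue_measure]_(t in `[0%R, 1%R])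
        ((1 - t ^+ 2) `^ (1 - alpha) / (2 * (alpha - 1)))%:E
      - (1 / (2 * (alpha - 1)))%:E
      + (pi / sin (pi * (alpha - 1)))%:E
      <= hilbert_bloch_opnorm alpha)%E)
  /\
  (forall alpha : R, 0 < alpha <= 1 \/ 2 <= alpha ->
     ~ hilbert_bounded_on_bloch alpha).
Proof.
split=> [alpha /andP[al1 al2]|alpha [/andP[al0 al1]|al2]]; last 2 first.
- move: al1; rewrite le_eqVlt => /predU1P[->|al1]; first exact: unbounded_1.
  exact: unbounded_lt1.
- exact: unbounded_ge2.
pose a := alpha - 1.
have a01 : 0 < a < 1 by rewrite subr_gt0 al1 ltrBlDr.
have aE : alpha = 1 + a by rewrite addrC subrK.
have r00 : 0 <= (0 : R) < 1 by rewrite lexx ltr01.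
(* A finite lower bound, which excludes the value -oo; at +oo the claim is trivial. *)
have opnorm_real := hilbert_opnorm_ge _ _ (test_coef_ge0 a01)
  (test_coef_cvg a01) (test_coef_norm a01) _ 0 r00.
have := test_integral_le a01; have := @opnorm_limit_ge _ _ a01.
rewrite -aE -/a; have -> : 1 - alpha = - a by rewrite opprB.
move: opnorm_real; rewrite -aE.
case: (hilbert_bloch_opnorm alpha) => [L _ /(_ L (lexx _)) HL HI|*|//].
  apply: le_trans (leeD2r _ (leeB HI (lexx _))) _.
  rewrite -EFinB -EFinD lee_fin div1r addrK.
  exact: HL.
exact: leey.
Qed.
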